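(* Let $G$ be a finite, undirected, simple graph on at least three vertices. If $G$ is $\frac{3}{2}$-tough and $(P_4 \cup P_{10})$-free, then $G$ has a $2$-factor.
   Context: All graphs are finite, undirected and simple. For a graph $G$, $\omega(G)$ denotes the number of connected components of $G$, and for $U \subset V(G)$, $G-U$ denotes the subgraph of $G$ induced on $V(G)\setminus U$. The toughness of $G$ is $t(G)=\min\left\{\frac{|U|}{\omega(G-U)} \mid U \subset V(G),\ \omega(G-U)\ge 2\right\}$, with $t(G)=\infty$ if $G$ is complete. For a real number $t$, $G$ is $t$-tough if $t(G)\ge t$; equivalently, $t\cdot\omega(G-U)\le |U|$ for every $U\subset V(G)$ with $\omega(G-U)\ge 2$. $P_n$ denotes the path with $n$ vertices, and $P_4\cup P_{10}$ is the disjoint union of $P_4$ and $P_{10}$ (with no edges between them). For a graph $H$, a graph $G$ is $H$-free if it contains no induced subgraph isomorphic to $H$. A $2$-factor of $G$ is a spanning subgraph of $G$ in which every vertex has degree $2$ (i.e. a spanning subgraph every component of which is a cycle). *)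

(* Defs.v *)
From HB Require Import structures.
From mathcomp Require Import all_boot all_order all_algebra.
From mathcomp Require Import constructive_ereal.

Set Implicit Arguments.
Unset Strict Implicit.
Unset Printing Implicit Defensive.

Import Order.TTheory GRing.Theory Num.Theory.

Record sgraph := SGraph {
  vertex :> finType;
  edge : rel vertex;
  edge_sym : symmetric edge;
  edge_irrefl : irreflexive edge }.

Definition isomorphic (G H : sgraph) : Prop :=
  exists2 f : G -> H, bijective f & forall x y, edge (f x) (f y) = edge x y.

Section Induced.
Variables (G : sgraph) (U : {set G}).

Definition induced_edge : rel {x : G | x \in U} :=
  fun x y => edge (val x) (val y).

Lemma induced_edge_sym : symmetric induced_edge.
Proof. by move=> x y; apply: edge_sym. Qed.

Lemma induced_edge_irrefl : irreflexive induced_edge.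
Proof. by move=> x; apply: edge_irrefl. Qed.

Definition induced : sgraph := SGraph induced_edge_sym induced_edge_irrefl.
End Induced.

Definition del_vertices (G : sgraph) (U : {set G}) : sgraph := induced (~: U).

Definition induced_free (H G : sgraph) : Prop :=
  ~ exists U : {set G}, isomorphic (induced U) H.

Section PathGraph.
Variable n : nat.

Definition path_edge : rel 'I_n :=
  fun i j => (i.+1 == j :> nat) || (j.+1 == i :> nat).

Lemma path_edge_sym : symmetric path_edge.
Proof. by move=> i j; rewrite /path_edge orbC. Qed.

Lemma path_edge_irrefl : irreflexive path_edge.
Proof. by move=> i; rewrite /path_edge orbb gtn_eqF. Qed.

Definition path_graph : sgraph := SGraph path_edge_sym path_edge_irrefl.
End PathGraph.

Section DisjointUnion.
Variables G H : sgraph.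

Definition union_edge : rel (G + H)%type :=
  fun u v => match u, v with
             | inl x, inl y => edge x y
             | inr x, inr y => edge x y
             | _, _ => false
             end.

Lemma union_edge_sym : symmetric union_edge.
Proof. by move=> [x|x] [y|y] //=; apply: edge_sym. Qed.

Lemma union_edge_irrefl : irreflexive union_edge.
Proof. by move=> [x|x] /=; apply: edge_irrefl. Qed.

Definition disjoint_union : sgraph := SGraph union_edge_sym union_edge_irrefl.
End DisjointUnion.

Definition components (G : sgraph) : nat := n_comp (@edge G) G.

(* The value is +oo exactly when the range is empty, i.e. when G is complete. *)
Definition toughness (G : sgraph) : \bar rat :=
  \big[Order.min/+oo%E]_(U : {set G} | (2 <= components (del_vertices U))%N)
    ((#|U|%:R / (components (del_vertices U))%:R)%R)%:E.

Definition tough (t : rat) (G : sgraph) : Prop := (t%:E <= toughness G)%E.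

Definition has_two_factor (G : sgraph) : Prop :=
  exists F : rel G,
    [/\ symmetric F, subrel F (@edge G) &
        forall x : G, #|[set y | F x y]| = 2%N].

(* Main.v *)
(* By the Tutte-Berge formula (proved through Gallai's lemma) and a gadget graph, a graph
   without 2-factor has a Tutte barrier: disjoint sets S, T with
   2|S| + sum_(y in T) d_(G-S)(y) + 2 <= 2|T| + h(S,T), where h counts the components of
   G - S - T sending an odd number of edges to T.  Take |S| maximal, then |T| minimal:
   then T is independent, T-edges go to odd components only, no two of them share an end
   vertex outside T, no vertex of T has two neighbours in one component, and deleting an
   attachment vertex from a component leaves pieces with an even number of attachments.

   View the components with at least 3 attachments as hyperedges on T.  Deleting S and the
   attachment vertices of the degree-1 vertices of T, 3/2-toughness together with the
   barrier inequality yields a connected family F of hyperedges with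
   |F| >= 4 + sum_y (d(y) - 2)^+.  Such a family contains hyperedges v1, ..., v4 and distinct
   vertices y1, ..., y6 forming a path y1 v1 y2 v2 y3 v3 y4 and a path y5 v4 y6; routing
   through the components gives an induced path on at least 10 vertices and a disjoint,
   non-adjacent one on at least 4 vertices. *)
From HB Require Import structures.
Require Import Defs.
From mathcomp Require Import all_boot all_order all_algebra.
From mathcomp Require Import constructive_ereal.
From mathcomp Require Import zify.

Set Implicit Arguments.
Unset Strict Implicit.
Unset Printing Implicit Defensive.

(** * Tutte-Berge formula *)

(** The lengths 10 and 4 come from crossings: a vertex outside [S] and [T] has at most one neighbour
    in [T], so crossing a component between two vertices of [T] uses at least two of its vertices.
    Three consecutive crossings give 4 + 6 vertices, a single one 2 + 2. The constant 4 is 3 + 1. By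
    toughness every class of [T] (linked by hyperedges) contributes 3 to twice the number of deleted
    vertices, and the barrier inequality keeps a slack of at least 1 after summation, so averaging
    yields a class with surplus 4. Cutting off a degree-1 vertex of [T] deletes one vertex (cost 2)
    and gains one component (worth 3); the net gain 1 raises its charge from 1 to 2, so that only
    degrees above 2 remain as a loss. The obstacle is that a path through a component may touch
    further vertices of [T]. With three attachments one can cross from a given attachment, end away
    from another prescribed vertex, and touch no vertex of [T] but the two ends. The middle crossing
    has to join two prescribed sets, and there only these two sets are kept off the path, which
    suffices because every other chosen vertex attached there belongs to one of them. *)

Section Involution.
Variables (V : finType).

Lemma odd_card_involutive (f : V -> V) (A : {set V}) :
  involutive f -> {in A, forall x, f x \in A} ->
  odd #|A| = odd #|[set x in A | f x == x]|.
Proof.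
move=> fK; move En : #|A| => n; elim/ltn_ind: n A En => n IH A An fA.
case: (set_0Vmem [set x in A | f x != x]) => [E|[x]].
  rewrite -An; congr (odd #|pred_of_set _|); apply/setP => x; rewrite inE.
  case xA: (x \in A) => //=; apply/esym.
  by have := in_set0 x; rewrite -E inE xA /= => /negbFE.
rewrite inE => /andP[xA nfx].
pose B := A :\ x :\ f x.
have fxAx : f x \in A :\ x by rewrite !inE nfx fA.
have cA : #|A| = #|B|.+2.
  by rewrite (cardsD1 x) xA (cardsD1 (f x) (A :\ x)) fxAx.
have -> : [set x0 in A | f x0 == x0] = [set x0 in B | f x0 == x0].
  apply/setP => z; rewrite !inE.
  case: (eqVneq z x) => [->|]; first by rewrite (negPf nfx) !andbF.
  case: (eqVneq z (f x)) => [->|] //=; by rewrite fK [x == _]eq_sym (negPf nfx) andbF.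
rewrite -An cA /= negbK; apply: (IH #|B|) => //; first by rewrite -An cA.
move=> z; rewrite !inE => /and3P[zfx zx zA]; rewrite fA // andbT.
by rewrite (can_eq fK) zx (inv_eq fK) zfx.
Qed.

(* With [h = g \o f], [g \o h^n = h^-n \o g]; hence the [h]-orbit of a [g]-fixed
   point is stable under both involutions. *)
Lemma iter_conj_invol (f g : V -> V) (n : nat) (v : V) :
  involutive f -> involutive g -> g v = v ->
  iter n (g \o f) (g (iter n (g \o f) v)) = v.
Proof.
move=> fK gK gv; elim: n => [|n IH]; first by rewrite /= gv.
by rewrite iterSr [iter n.+1 _ v]iterS /= gK fK.
Qed.
End Involution.

Section TutteBerge.
Variables (V : finType) (e : rel V).
Hypothesis e_sym : symmetric e.

(** Encoded as an involution of the whole vertex type: unmatched vertices, and all vertices outside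
    [W], are its fixed points, so orbits and parity arguments apply directly. *)
Definition matching (W : {set V}) (f : {ffun V -> V}) : bool :=
  [forall x, (f (f x) == x) &&
     ((f x != x) ==> [&& x \in W, f x \in W & e x (f x)])].

Definition missed (W : {set V}) (f : {ffun V -> V}) : {set V} :=
  [set x in W | f x == x].

Definition max_matching (W : {set V}) (f : {ffun V -> V}) : bool :=
  matching W f && [forall g, matching W g ==> (#|missed W f| <= #|missed W g|)].

(** A labelling stands in for the components of the graph on [W :\: X]. A class may be a union of
    components, but an odd class contains an odd component, so counting odd classes never
    overestimates. *)
Definition separates (L : finType) (X W : {set V}) (k : V -> L) : Prop :=
  forall x y, x \in W :\: X -> y \in W :\: X -> e x y -> k x = k y.

Definition odd_classes (L : finType) (Y : {set V}) (k : V -> L) : {set L} :=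
  [set i | odd #|[set x in Y | k x == i]|].

Lemma matchingK W f : matching W f -> involutive f.
Proof. by move=> /forallP fM x; have /andP[/eqP] := fM x. Qed.

Lemma matchingE W f x : matching W f -> f x != x ->
  [/\ x \in W, f x \in W & e x (f x)].
Proof. by move=> /forallP fM nfx; have /andP[_] := fM x; rewrite nfx => /and3P. Qed.

Lemma matching_intro (W : {set V}) (f : V -> V) : involutive f ->
  (forall x, f x != x -> [/\ x \in W, f x \in W & e x (f x)]) ->
  matching W (finfun f).
Proof.
move=> fK fE; apply/forallP => x; rewrite !ffunE fK eqxx /=.
by apply/implyP => /fE[-> -> ->].
Qed.

Lemma exists_max_matching W : exists f, max_matching W f.
Proof.
have id0 : matching W [ffun x => x].
  by apply/forallP => x; rewrite !ffunE !eqxx.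
case: (arg_minnP (fun f => #|missed W f|) id0) => f fM fmin.
by exists f; rewrite /max_matching fM; apply/forallP => g; apply/implyP => /fmin.
Qed.

Lemma odd_missed W f : matching W f -> odd #|missed W f| = odd #|W|.
Proof.
move=> fM; have fK := matchingK fM.
rewrite (@odd_card_involutive _ f W) // => x xW.
by case: (eqVneq (f x) x) => [->|/(matchingE fM)[]].
Qed.

(** The two matchings obtained by exchanging [f] and [g] on [P] miss together as many vertices as
    [f] and [g] do; since the second misses at least as many as [g], the first misses at most as
    many as [f]. *)
Lemma max_matching_switch W (f g : {ffun V -> V}) (P : {set V}) :
  max_matching W f -> max_matching W g ->
  (forall x, x \in P -> f x \in P) -> (forall x, x \in P -> g x \in P) ->
  max_matching W [ffun x => if x \in P then g x else f x].
Proof.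
move=> /andP[fM /forallP fmin] /andP[gM /forallP gmin] fP gP.
have sw (a b : {ffun V -> V}) : matching W a -> matching W b ->
    (forall x, x \in P -> a x \in P) -> (forall x, x \in P -> b x \in P) ->
    matching W [ffun x => if x \in P then b x else a x].
  move=> aM bM aP bP; have aK := matchingK aM; have bK := matchingK bM.
  have aP' x : (a x \in P) = (x \in P).
    by apply/idP/idP => [/aP|/aP //]; rewrite aK.
  apply: matching_intro => x.
    by case xP: (x \in P); rewrite ?(bP _ xP) ?bK // aP' xP aK.
  by case: (x \in P); apply: matchingE.
have fgM := sw f g fM gM fP gP; have gfM := sw g f gM fM gP fP.
rewrite /max_matching fgM; apply/forallP => m; apply/implyP => mM.
set u := [ffun x => _]; set w := [ffun x => if x \in P then f x else g x] in gfM.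
have E : #|missed W u| + #|missed W w| = #|missed W f| + #|missed W g|.
  have split a : #|missed W a| = #|missed W a :&: P| + #|missed W a :\: P|.
    by rewrite cardsID.
  rewrite !split.
  have -> : missed W u :&: P = missed W g :&: P.
    by apply/setP => x; rewrite !inE ffunE; case: (x \in P); rewrite ?andbF.
  have -> : missed W u :\: P = missed W f :\: P.
    by apply/setP => x; rewrite !inE ffunE; case: (x \in P).
  have -> : missed W w :&: P = missed W f :&: P.
    by apply/setP => x; rewrite !inE ffunE; case: (x \in P); rewrite ?andbF.
  have -> : missed W w :\: P = missed W g :\: P.
    by apply/setP => x; rewrite !inE ffunE; case: (x \in P).
  lia.
have := fmin m; have := gmin w; rewrite gfM mM /=; lia.
Qed.

(* Gallai's argument: the component of [v] in the union of both matchings contains at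
   most one of [u] and [w]; switch along it. *)
Lemma missed_trans W (f g : {ffun V -> V}) u v w :
  max_matching W f -> max_matching W g ->
  u \in missed W f -> w \in missed W f -> v \in missed W g -> u != w ->
  exists m, max_matching W m /\
    ((u \in missed W m) && (v \in missed W m) \/
     (v \in missed W m) && (w \in missed W m)).
Proof.
move=> fM gM; rewrite !inE => /andP[uW /eqP fu] /andP[wW /eqP fw] /andP[vW /eqP gv] uw.
have fK := matchingK (proj1 (andP fM)); have gK := matchingK (proj1 (andP gM)).
pose h := g \o f; pose P := [set x in orbit h v].
have hinj : injective h by apply: inj_comp; apply: can_inj.
have memP x : x \in P = fconnect h v x by rewrite inE fconnect_orbit.
have itP n : iter n h v \in P by rewrite memP fconnect_iter.
have gP x : x \in P -> g x \in P.
  rewrite memP => /iter_findex <-; set n := findex _ _ _.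
  have := iter_conj_invol n fK gK gv; rewrite -/h => E.
  by rewrite memP (fconnect_sym hinj) -{2}E fconnect_iter.
have fP x : x \in P -> f x \in P.
  move=> xP; rewrite -(gK (f x)); apply: gP.
  by move: xP; rewrite !memP => /connect_trans; apply; apply: (fconnect1 h).
have one : ~~ ((u \in P) && (w \in P)).
  (* An [f]-fixed point at position [i] of the orbit makes [2i + 1] a period of [v]. Two odd periods
     [2a + 1] and [2b + 1] make [2(b - a)], hence also [b - a], a period, so the two fixed points
     coincide. *)
  have period x i : f x = x -> x = iter i h v -> iter i.*2.+1 h v = v.
    move=> fx xi; have := iter_conj_invol i.+1 fK gK gv; rewrite -/h.
    have hx : h x = g x by rewrite /h /= fx.
    rewrite [iter i.+1 h v]iterS -xi hx gK {1}xi -iterD.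
    by rewrite addSn addnn.
  apply/negP => /andP[]; rewrite !memP => /iter_findex.
  set i := findex _ _ _ => ui /iter_findex; set j := findex _ _ _ => wj.
  have iti := period u i fu (esym ui); have itj := period w j fw (esym wj).
  suff {uw} contra a b : iter a.*2.+1 h v = v -> iter b.*2.+1 h v = v -> a <= b ->
      iter b h v = iter a h v.
    case: (leqP i j) => ij; move: uw; rewrite -ui -wj.
      by rewrite (contra i j) // eqxx.
    by rewrite (contra j i) ?eqxx // ltnW.
  move=> ha hb ab; pose m := b - a.
  have per q k : iter q h v = v -> iter (q * k) h v = v.
    by move=> hq; elim: k => [|k IH]; rewrite ?muln0 // mulnS iterD IH.
  have h2m : iter m.*2 h v = v.
    have itI q : injective (iter q h) by elim: q => [|q IH] x y //= /hinj/IH.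
    apply: (itI a.*2.+1); rewrite -iterD ha.
    by have -> : a.*2.+1 + m.*2 = b.*2.+1 by rewrite /m; lia.
  have hm : iter m h v = v.
    have := per _ m ha; have -> : a.*2.+1 * m = m + m.*2 * a by nia.
    by rewrite iterD (per _ a h2m).
  by rewrite -(subnKC ab) iterD hm.
pose m := [ffun x => if x \in P then g x else f x].
have mM : max_matching W m by apply: max_matching_switch.
have vm : v \in missed W m.
  by rewrite inE vW ffunE (itP 0) gv eqxx.
exists m; split=> //; rewrite vm andbT /= !inE uW wW !ffunE.
case: (boolP (u \in P)) one => uP //= wP; last by left; rewrite fu.
by right; rewrite (negPf wP) fw.
Qed.

Lemma max_matching_missed_nonadj W f x y :
  max_matching W f -> x \in missed W f -> y \in missed W f -> x != y -> ~~ e x y.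
Proof.
move=> /andP[fM /forallP fmin]; rewrite !inE => /andP[xW /eqP fx] /andP[yW /eqP fy] xy.
have fK := matchingK fM.
apply/negP => exy.
pose g := [ffun z => if z == x then y else if z == y then x else f z].
have gM : matching W g.
  apply: matching_intro => z.
    case: (eqVneq z x) => [->|zx]; first by rewrite [y == x]eq_sym (negPf xy) eqxx.
    case: (eqVneq z y) => [->|zy]; first by rewrite eqxx.
    have -> : (f z == x) = false by rewrite -{1}fx (can_eq fK) (negPf zx).
    by have -> : (f z == y) = false; [rewrite -{1}fy (can_eq fK) (negPf zy)|rewrite fK].
  case: (eqVneq z x) => [->|zx] //; case: (eqVneq z y) => [->|zy] nfz.
    by split; rewrite // e_sym.
  exact: matchingE.
have := fmin g; rewrite gM /= leqNgt => /negP; apply; apply: proper_card.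
apply/properP; split.
  apply/subsetP => z; rewrite !inE ffunE => /andP[-> /=].
  case: (eqVneq z x) => [->|zx]; first by rewrite fx.
  by case: (eqVneq z y) => [->|zy]; first by rewrite fy.
exists x; first by rewrite inE xW fx eqxx.
by rewrite inE ffunE eqxx eq_sym (negPf xy) andbF.
Qed.

(** Induction on [W]. A vertex covered by every maximum matching goes into [X]. If there is none,
    being never missed together is an equivalence relation by [missed_trans], its classes are closed
    under adjacency, and [X] can be empty. *)
Theorem tutte_berge W f : max_matching W f ->
  exists (X : {set V}) (k : V -> {set V}), [/\ X \subset W, separates X W k &
    #|missed W f| + #|X| <= #|odd_classes (W :\: X) k| ].
Proof.
move Wn : #|W| => n; elim: n W Wn f => [|n IH] W Wn f fM.
  have W0 : W = set0 by apply/eqP; rewrite -cards_eq0 Wn.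
  exists set0, (fun=> set0); split; rewrite ?sub0set // W0 ?cards0.
  by have -> : missed set0 f = set0 by [apply/setP => x; rewrite !inE]; rewrite cards0.
have [fm /forallP fmin] := andP fM.
case: (boolP [exists v in W, [forall g, max_matching W g ==> (v \notin missed W g)]]).
  case/exists_inP => v vW /forallP vcov.
  have [f' f'M] := exists_max_matching (W :\ v).
  have cW' : #|W :\ v| = n by move: Wn; rewrite (cardsD1 v) vW => -[].
  have [X [k [XW kX kodd]]] := IH _ cW' _ f'M.
  have WX : W :\: (v |: X) = W :\ v :\: X by rewrite setDDl.
  exists (v |: X), k; split.
  - by rewrite subUset sub1set vW (subset_trans XW) ?subsetDl.
  - by move=> x y; rewrite WX; apply: kX.
  have vX : v \notin X by apply/negP => /(subsetP XW); rewrite !inE eqxx.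
  rewrite WX cardsU1 vX /=; apply: leq_trans kodd.
  (* Missing [v], the matching [f'] is not maximum on [W]; by parity it then misses at least two
     vertices more than [f]. One of them is [v], the other pays for putting [v] into [X]. *)
  suff : #|missed W f| < #|missed (W :\ v) f'| by lia.
  have f'm : matching W f'.
    have f'm := proj1 (andP f'M).
    apply/forallP => x; rewrite (matchingK f'm) eqxx /=; apply/implyP.
    by case/(matchingE f'm) => /setD1P[_ xW] /setD1P[_ fxW] ex; apply/and3P.
  have f'v : f' v = v.
    apply/eqP; apply/negPn/negP => /(matchingE (proj1 (andP f'M))).
    by rewrite !inE eqxx => -[].
  have mE : missed W f' = v |: missed (W :\ v) f'.
    apply/setP => x; rewrite !inE; case: (eqVneq x v) => [->|] //=; by rewrite f'v vW eqxx.
  have cm : #|missed W f'| = #|missed (W :\ v) f'|.+1.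
    by rewrite mE cardsU1 !inE eqxx.
  have lt : #|missed W f| < #|missed W f'|.
    rewrite ltnNge; apply/negP => le; have := vcov f'.
    rewrite mE setU11 /= implybF => /negP; apply; rewrite /max_matching f'm.
    apply/forallP => g; apply/implyP => gM; apply: leq_trans le _.
    by have := fmin g; rewrite gM.
  have := odd_missed fm; rewrite -(odd_missed f'm) cm => par.
  move: lt; rewrite cm ltnS leq_eqVlt => /orP[/eqP E|//].
  by move: par; rewrite E /=; case: odd.
rewrite negb_exists_in => /forall_inP ncov.
have miss v : v \in W -> exists2 g, max_matching W g & v \in missed W g.
  move=> /ncov; rewrite negb_forall => /existsP[g].
  by rewrite negb_imply negbK => /andP[]; exists g.
(* Gallai's relation: [u] and [w] are never missed by the same maximum matching. *)
pose R u w := (u == w) || [forall g, max_matching W g ==>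
   ~~ ((u \in missed W g) && (w \in missed W g))].
have Rsym u w : R u w = R w u.
  by rewrite /R eq_sym; congr (_ || _); apply: eq_forallb => g; rewrite andbC.
have Rtrans u v w : v \in W -> R u v -> R v w -> R u w.
  move=> vW; rewrite /R; case: (eqVneq u v) => [->|uv] //=.
  case: (eqVneq v w) => [<-|vw] /=; first by move=> ->; rewrite orbT.
  move=> /forallP uv' /forallP vw'.
  case: (eqVneq u w) => [->|uw] //=; apply/forallP => g; apply/implyP => gM.
  apply/negP => /andP[ug wg]; have [g' g'M vg'] := miss v vW.
  have [m [mM]] := missed_trans gM g'M ug wg vg' uw.
  by have := uv' m; have := vw' m; rewrite mM /= => /negPf -> /negPf -> [].
pose k x := [set y in W | R x y].
have kE x y : x \in W -> y \in W -> (k x == k y) = R x y.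
  move=> xW yW; apply/eqP/idP => [/setP/(_ y)|Rxy]; first by rewrite !inE yW {2}/R eqxx.
  apply/setP => z; rewrite !inE; case zW: (z \in W) => //=.
  by apply/idP/idP; apply: Rtrans; rewrite // Rsym.
have sep : separates set0 W k.
  move=> x y; rewrite !setD0 => xW yW exy; apply/eqP; rewrite kE // /R.
  case: (eqVneq x y) => //= xy; apply/forallP => g; apply/implyP => gM.
  by apply/negP => /andP[xg yg]; have := max_matching_missed_nonadj gM xg yg xy; rewrite exy.
exists set0, k; split=> //; first exact: sub0set.
rewrite cards0 addn0 setD0.
have kinj : {in missed W f &, injective k}.
  move=> x y xf yf /eqP; rewrite kE; first last.
  - by move: yf; rewrite inE => /andP[].
  - by move: xf; rewrite inE => /andP[].
  by case/orP => [/eqP//|/forallP/(_ f)]; rewrite fM xf yf.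
rewrite -(card_in_imset kinj); apply: subset_leq_card; apply/subsetP => _ /imsetP[x xf ->].
have xW : x \in W by move: xf; rewrite inE => /andP[].
(* [f] preserves the class of a missed vertex [x] and fixes nothing else in it, so the class is
   odd. *)
rewrite inE (odd_card_involutive (matchingK fm)); last first.
  move=> z; rewrite !inE => /andP[zW /eqP kz].
  case: (eqVneq (f z) z) => [->|/(matchingE fm)[_ fzW ezf]]; first by rewrite zW kz eqxx.
  by rewrite fzW -kz eq_sym; apply/eqP/sep; rewrite ?setD0.
have -> : [set z in [set z in W | k z == k x] | f z == z] = [set x]; last by rewrite cards1.
apply/setP => z; rewrite !inE; apply/idP/eqP => [/andP[/andP[zW /eqP kz] fz]|->].
  by apply: kinj => //; rewrite inE zW.
by rewrite xW eqxx; move: xf; rewrite inE => /andP[].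
Qed.

Corollary tutte : irreflexive e ->
  (exists2 f : V -> V, involutive f & forall x, e x (f x)) \/
  exists (X : {set V}) (k : V -> {set V}), separates X setT k /\
    #|X| < #|odd_classes (~: X) k|.
Proof.
move=> e_irr; have [f fM] := exists_max_matching setT.
have [m0|m0] := eqVneq (missed setT f) set0.
  left; have fm := proj1 (andP fM); exists f; first exact: matchingK fm.
  move=> x; have [|_ _ //] := @matchingE _ _ x fm; apply/negP => /eqP fx.
  by have := in_set0 x; rewrite -m0 !inE fx eqxx.
have [X [k [_ kX kodd]]] := tutte_berge fM.
right; exists X, k; split=> //; rewrite -setTD; apply: leq_trans kodd.
by rewrite -addn1 addnC leq_add2r card_gt0.
Qed.

(** Freeing [z] glues it to classes [i] and [j], which may coincide. Two odd classes could be lost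
    only if [i] and [j] are distinct and both odd, but then the merged class has size 1 + odd + odd
    and is odd again. *)
Lemma merge_classes (L : finType) (X : {set V}) (k : V -> L) z i j :
  separates X setT k -> z \in X ->
  (forall y, y \notin X -> e z y -> (k y == i) || (k y == j)) ->
  let k' y := if y == z then i else if k y == j then i else k y in
  separates (X :\ z) setT k' /\
  #|odd_classes (~: X) k| <= #|odd_classes (~: (X :\ z)) k'|.+1.
Proof.
move=> sepk zX nbr k'; split.
  have nz y : y \notin X -> e z y -> (if k y == j then i else k y) = i.
    by move=> yX /(nbr y yX); case: (k y == j) => //; rewrite orbF => /eqP.
  have k'z y : y \in setT :\: (X :\ z) -> e z y -> k' y = i.
    rewrite /k' !inE; case: eqVneq => //= _; rewrite !andbT => yX; exact: nz.
  move=> x y xX yX; have := k'z x xX; have := k'z y yX; move: xX yX.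
  rewrite /k' !inE; case: (eqVneq x z) => [->|xz] /=.
    by move=> _ _ h _ /h ->.
  case: (eqVneq y z) => [->|yz] /= xX yX.
    by move=> _ h exz; apply: h; rewrite e_sym.
  move=> _ _ exy; rewrite (sepk x y) // !inE ?xX ?yX //.
pose A := odd_classes (~: X) k; pose A' := odd_classes (~: (X :\ z)) k'.
rewrite -/A -/A'.
have zi l : l != i -> l != j -> (l \in A) = (l \in A').
  move=> li lj; rewrite !inE; congr (odd #|pred_of_set _|); apply/setP => y; rewrite !inE /k'.
  case: (eqVneq y z) => [->|yz] /=; first by rewrite zX /= eq_sym (negPf li).
  case: (eqVneq (k y) j) => [->|] //.
  by rewrite eq_sym (negPf lj) [i == _]eq_sym (negPf li).
have sub : A :\ i :\ j \subset A' :\ i :\ j.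
  apply/subsetP => l; rewrite !in_setD1 => /and3P[lj li lA].
  by rewrite lj li -zi.
have cA' : #|A :\ i :\ j| <= #|A' :\ i :\ j| by apply: subset_leq_card.
have DA' : (i \in A') + #|A' :\ i :\ j| <= #|A'|.
  by rewrite (cardsD1 i A') leq_add2l (cardsD1 j (A' :\ i)) leq_addl.
have DA : #|A| = (i \in A) + ((j != i) && (j \in A)) + #|A :\ i :\ j|.
  by rewrite (cardsD1 i A) (cardsD1 j (A :\ i)) in_setD1 addnA.
case: (boolP [&& i \in A, j != i & j \in A]) => [/and3P[iA ji jA]|nij]; last first.
  suff : (i \in A) + ((j != i) && (j \in A)) <= 1 by lia.
  by move: nij; case: (i \in A); case: (j \in A); case: (j == i).
suff : i \in A' by move=> iA'; move: DA DA'; rewrite iA ji jA iA' /=; lia.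
move: iA jA; rewrite !inE => oi oj.
have -> : [set x in ~: (X :\ z) | k' x == i] =
    z |: ([set x in ~: X | k x == i] :|: [set x in ~: X | k x == j]).
  apply/setP => y; rewrite !inE /k'.
  case: (eqVneq y z) => [->|yz] /=; first by rewrite eqxx.
  by case: (y \in X) => //=; case: (k y == j); rewrite ?eqxx ?orbT ?orbF.
rewrite cardsU1 cardsU !inE zX /=.
have -> : [set x in ~: X | k x == i] :&: [set x in ~: X | k x == j] = set0.
  apply/setP => y; rewrite !inE; case: (eqVneq (k y) i) => [->|] //=; rewrite ?andbF //.
  by rewrite eq_sym (negPf ji) !andbF.
by rewrite cards0 subn0 !oddD oi oj.
Qed.

(* As long as some [z \in X] sees at most two classes, it can be dropped from [X]. *)
Lemma irreducible_certificate (L : finType) (X : {set V}) (k : V -> L) :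
  separates X setT k -> #|X| < #|odd_classes (~: X) k| ->
  exists (Y : {set V}) (l : V -> L), [/\ separates Y setT l,
    #|Y| < #|odd_classes (~: Y) l| &
    forall z i j, z \in Y -> exists y, [/\ y \notin Y, e z y, l y != i & l y != j] ].
Proof.
move Xn : #|X| => n; elim: n X Xn k => [|n IH] X Xn k sepk kodd.
  exists X, k; rewrite Xn; split=> // z i j.
  by move/eqP: Xn; rewrite cards_eq0 => /eqP ->; rewrite inE.
case: (boolP [exists z in X, [exists i, [exists j,
    [forall y, (y \notin X) && e z y ==> (k y == i) || (k y == j)]]]]).
  case/exists_inP => z zX /existsP[i /existsP[j /forallP nbr]].
  have {}nbr y : y \notin X -> e z y -> (k y == i) || (k y == j).
    by move=> yX ezy; have := nbr y; rewrite yX ezy.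
  have [sepk' kodd'] := merge_classes sepk zX nbr.
  have cX : #|X :\ z| = n by move: Xn; rewrite (cardsD1 z) zX => -[].
  by apply: (IH _ cX _ sepk'); lia.
rewrite negb_exists_in => /forall_inP nred.
exists X, k; rewrite Xn; split=> // z i j /nred.
rewrite negb_exists => /forallP/(_ i); rewrite negb_exists => /forallP/(_ j).
rewrite negb_forall => /existsP[y]; rewrite negb_imply negb_or => /andP[/andP[yX ezy] /andP[yi yj]].
by exists y.
Qed.
End TutteBerge.

(** * Barriers for 2-factors *)

Section Gadget.
Variable G : sgraph.

Definition nbh (x : G) : {set G} := [set y | edge x y].

Definition dart : predArgType := {d : G * G | edge d.1 d.2}.

Lemma dart_rev_subproof (d : dart) : edge (val d).2 (val d).1.
Proof. by rewrite edge_sym; case: d. Qed.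

Definition dart_rev (d : dart) : dart :=
  exist _ ((val d).2, (val d).1) (dart_rev_subproof d).

Lemma dart_revK : involutive dart_rev.
Proof. by case=> [[x y] exy]; apply: val_inj. Qed.

Lemma dart_rev_neq d : dart_rev d != d.
Proof.
case: d => [[x y] exy]; apply/eqP => /(congr1 (fun d => (val d).1)) /= yx.
by move: exy; rewrite /= yx edge_irrefl.
Qed.

(* Two copies of every vertex, and for every edge [vw] a path of length 3 from the
   copies of [v] to those of [w]: a perfect matching of this graph encodes a 2-factor,
   an edge [vw] being used when its two darts are matched to vertex copies. *)
Definition gadget_edge (u v : (G * bool) + dart) : bool :=
  match u, v with
  | inl x, inr d => x.1 == (val d).1
  | inr d, inl x => x.1 == (val d).1
  | inr d, inr d' => d' == dart_rev d
  | inl _, inl _ => false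
  end.

Lemma gadget_sym : symmetric gadget_edge.
Proof. by move=> [x|d] [y|d'] //=; rewrite eq_sym (can2_eq dart_revK dart_revK). Qed.

Lemma gadget_irrefl : irreflexive gadget_edge.
Proof. by move=> [x|d] //=; rewrite eq_sym (negPf (dart_rev_neq d)). Qed.

(** A dart not matched to its reverse is matched to a copy of its source, so the two darts of an
    edge are used together; the two copies of [x] select exactly two used darts leaving [x]. *)
Lemma gadget_matching_two_factor (f : (G * bool) + dart -> (G * bool) + dart) :
  involutive f -> (forall u, gadget_edge u (f u)) -> has_two_factor G.
Proof.
move=> fK fE.
pose used d := if f (inr d) is inl _ then true else false.
pose F x y := [exists d : dart, (val d == (x, y)) && used d].
have used_rev d : used (dart_rev d) = used d.
  have imp d' : used (dart_rev d') -> used d'.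
    rewrite /used; case E : (f (inr d')) => [//|d2].
    have := fE (inr d'); rewrite E /= => /eqP d2E.
    by rewrite -d2E -E fK.
  apply/idP/idP; first exact: imp.
  by rewrite -{1}(dart_revK d); apply: imp.
exists F; split.
- move=> x y; apply/existsP/existsP => -[d /andP[/eqP dE ud]];
    by exists (dart_rev d); rewrite used_rev ud andbT /= dE.
- by move=> x y /existsP[d /andP[/eqP dE _]]; have := valP d; rewrite dE.
move=> x.
have fD b : exists2 d : dart, f (inl (x, b)) = inr d & (val d).1 = x.
  have := fE (inl (x, b)); case E : (f _) => [//|d] /= /eqP xd.
  by exists d.
have [d1 f1 x1] := fD true; have [d2 f2 x2] := fD false.
have F1 d : (val d).1 = x -> used d -> d = d1 \/ d = d2.
  rewrite /used => dx; case E : (f (inr d)) => [[z b]|//] _.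
  have := fE (inr d); rewrite E /= dx => /eqP zx; rewrite {}zx in E.
  have E' : f (inl (x, b)) = inr d by rewrite -E fK.
  by case: b E E' => _; rewrite ?f1 ?f2 => -[->]; [left|right].
have dE (d : dart) : val d = ((val d).1, (val d).2) by case: (val d).
have -> : [set y | F x y] = [set (val d1).2; (val d2).2].
  apply/setP => y; rewrite !inE; apply/existsP/orP.
    case=> d /andP[/eqP dxy ud].
    have dx : (val d).1 = x by rewrite dxy.
    by case: (F1 d dx ud) dxy => -> ->; [left|right].
  case=> /eqP ->; [exists d1|exists d2]; rewrite dE ?x1 ?x2 eqxx /used.
    by rewrite -f1 fK.
  by rewrite -f2 fK.
rewrite cards2; case: eqP => //= d12; exfalso.
have d12' : d1 = d2 by apply: val_inj; rewrite dE [RHS]dE x1 x2 d12.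
by have := fK (inl (x, true)); rewrite f1 d12' -f2 fK.
Qed.

Lemma dart_count (P : G -> G -> bool) :
  #|[set d : dart | P (val d).1 (val d).2]| = \sum_x #|[set y in nbh x | P x y]|.
Proof.
rewrite -(card_imset _ val_inj).
transitivity #|[set p : G * G | edge p.1 p.2 && P p.1 p.2]|.
  apply: eq_card => p; rewrite inE; apply/imsetP/andP.
    by case=> d; rewrite inE => Pd ->; split=> //; exact: (valP d).
  by case=> ep Pp; exists (exist _ p ep : dart) => //; rewrite inE.
rewrite -sum1_card (eq_bigr (fun x => \sum_(y in [set y in nbh x | P x y]) 1)) => [|x _].
  by rewrite pair_big_dep /=; apply: eq_bigl => -[x y]; rewrite !inE.
by rewrite sum1_card.
Qed.

Definition label_class (L : finType) (R : {set G}) (k : G -> L) i :=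
  [set v in R | k v == i].

(** In an irreducible Tutte set [X] of the gadget graph every member sees three classes. This forces
    [X] to consist of both copies of the vertices of a set [S] and all darts leaving a set [T]. The
    odd classes are then charged to copies of [T], to darts from [S] to [T], or to labels with an
    odd number of edges to [T]. *)
Theorem two_factor_or_labels : has_two_factor G \/
  exists (S T : {set G}) (L : finType) (k : G -> L), [/\ [disjoint S & T],
    forall x y, x \notin S :|: T -> y \notin S :|: T -> edge x y -> k x = k y &
    2 * #|S| + \sum_(y in T) #|nbh y :\: S| <
    2 * #|T| + #|[set i | odd (\sum_(v in label_class (~: (S :|: T)) k i) #|nbh v :&: T|)]| ].
Proof.
have [[f fK fE]|[X0 [k0 [sep0 odd0]]]] := tutte gadget_sym gadget_irrefl.
  by left; apply: gadget_matching_two_factor fK fE.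
right; have {X0 k0 sep0 odd0} [X [k [sep oddk red]]] :=
  irreducible_certificate gadget_sym sep0 odd0.
pose L := {set ((G * bool) + dart)%type}.
have sepk u v : u \notin X -> v \notin X -> gadget_edge u v -> k u = k v.
  by move=> uX vX; apply: sep; rewrite !inE ?uX ?vX.
(* Both copies of [v] have the same neighbours; if one copy is outside [X], the other sees only its
   class. *)
have copies v b c : inl (v, b) \in X -> inl (v, c) \in X.
  move=> vb; apply/negPn/negP => vc.
  have [[u [_ //]|d [dX /= vd]]] := red _ (k (inl (v, c))) (k (inl (v, c))) vb.
  by rewrite (sepk (inr d) (inl (v, c))) //= ?eqxx.
(* A dart has exactly three neighbours, namely the copies of its source and its reverse, so all
   three lie outside [X] and in different classes. *)
have dartX (d : dart) : inr d \in X ->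
    [/\ forall b, inl ((val d).1, b) \notin X, inr (dart_rev d) \notin X
      & k (inl ((val d).1, true)) != k (inl ((val d).1, false))].
  move=> dX; pose v := (val d).1; pose r : (G * bool) + dart := inr (dart_rev d).
  have nb u : gadget_edge (inr d) u -> (exists b, u = inl (v, b)) \/ u = r.
    case: u => [[w b]|d'] /= /eqP => [->|->]; [by left; exists b|by right].
  have cop : forall b, inl (v, b) \notin X.
    move=> b; apply/negP => vb.
    have [u [uX /nb[[c uE]|->]]] := red _ (k r) (k r) dX; last by rewrite eqxx.
    by move: uX; rewrite uE (copies v b c).
  split=> //.
    apply/negP => rX; have [u [uX /nb[[b ->]|uE]]] :=
      red _ (k (inl (v, true))) (k (inl (v, false))) dX.
      by case: b; rewrite eqxx.
    by move: uX; rewrite uE rX.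
  apply/eqP => kE; have [u [uX /nb[[b ->]|->]]] := red _ (k (inl (v, true))) (k r) dX.
    by case: b; rewrite ?kE eqxx.
  by rewrite eqxx.
pose S := [set v | inl (v, true) \in X].
pose T := [set v | (v \notin S) && [forall d : dart, ((val d).1 == v) ==> (inr d \in X)]].
have SX v b : (inl (v, b) \in X) = (v \in S).
  by rewrite inE; apply/idP/idP; apply: copies.
have TX (d : dart) : (inr d \in X) = ((val d).1 \in T).
  apply/idP/idP => [dX|]; last first.
    by rewrite inE => /andP[_ /forallP/(_ d)]; rewrite eqxx.
  have [cop _ kne] := dartX d dX; rewrite inE -(SX _ true) cop /=.
  (* A dart [d'] from the same source outside [X] would put the two copies of the source into one
     class. *)
  apply/forallP => d'; apply/implyP => /eqP dd'; apply/negPn/negP => d'X.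
  case/eqP: kne; transitivity (k (inr d')).
    by apply: sepk; rewrite ?cop //= dd'.
  by apply: sepk; rewrite ?cop //= dd'.
have ST : [disjoint S & T].
  by rewrite -setI_eq0; apply/eqP/setP => v; rewrite !inE; case: (_ \in X).
have revT (d : dart) : (val d).1 \in T -> (val d).2 \notin T.
  by rewrite -TX => /dartX[_ + _]; rewrite TX.
have TE v : (v \in T) = (v \notin S) && [forall d : dart, ((val d).1 == v) ==> (inr d \in X)].
  by rewrite inE.
clearbody T; clearbody S.
pose R := ~: (S :|: T).
pose kR v := k (inl (v, true)).
have kRd (d : dart) : (val d).1 \in R -> inr d \notin X /\ k (inr d) = kR (val d).1.
  rewrite in_setC in_setU negb_or => /andP[vS vT].
  have dX : inr d \notin X by rewrite TX.
  by split=> //; apply: sepk; rewrite ?SX //= eqxx.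
have kRE v b : v \in R -> k (inl (v, b)) = kR v.
  move=> vR; move: (vR); rewrite in_setC in_setU negb_or => /andP[vS].
  rewrite TE vS negb_forall => /existsP[d]; rewrite negb_imply => /andP[/eqP dv dX].
  have dR : (val d).1 \in R by rewrite dv.
  by have [_] := kRd d dR; rewrite dv => <-; apply: sepk; rewrite ?SX //= dv.
exists S, T, L, kR; split=> //.
  move=> x y xR yR exy; pose d : dart := exist _ (x, y) exy.
  rewrite -[x \notin _]in_setC in xR; rewrite -[y \notin _]in_setC in yR.
  have [dX dE] := kRd d xR; have [d'X d'E] := kRd (dart_rev d) yR.
  by rewrite -[kR x]dE -[kR y]d'E; apply: sepk => //=.
have cX : #|X| = 2 * #|S| + \sum_(y in T) #|nbh y|.
  rewrite -sum1_card big_sumType /=; congr (_ + _).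
    rewrite (eq_bigl (fun p => (p.1 \in S) && true)) => [|[v b]]; last by rewrite SX andbT.
    rewrite -(pair_big (mem S) xpredT (fun _ _ => 1)) /= mulnC -sum_nat_const.
    by apply: eq_bigr => v _; rewrite big_bool.
  rewrite (eq_bigl (fun d : dart => d \in [set d : dart | (val d).1 \in T])) => [|d].
    rewrite sum1_card (dart_count (fun x _ => x \in T)) [RHS]big_mkcond.
    apply: eq_bigr => v _; case: ifP => vT; first by apply: eq_card => y; rewrite !inE ?vT ?andbT.
    by apply/eqP; rewrite cards_eq0; apply/eqP/setP => y; rewrite !inE ?vT ?andbF.
  by rewrite inE -TX.
pose I := [set i | odd (\sum_(v in label_class (~: (S :|: T)) kR i) #|nbh v :&: T|)].
pose O1 := [set k (inl p) | p in setX T [set: bool]].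
pose O2 := [set k (inr d) | d in [set d : dart | ((val d).1 \in S) && ((val d).2 \in T)]].
have cO1 : #|O1| <= 2 * #|T|.
  by apply: leq_trans (leq_imset_card _ _) _; rewrite cardsX cardsT card_bool mulnC.
have cO2 : #|O2| <= \sum_(y in T) #|nbh y :&: S|.
  apply: leq_trans (leq_imset_card _ _) _.
  rewrite -(card_imset _ (can_inj dart_revK)).
  rewrite (_ : [set dart_rev d | d in _] =
      [set d : dart | ((val d).2 \in S) && ((val d).1 \in T)]); last first.
    apply/setP => d; apply/imsetP/idP => [[d']|]; rewrite inE => dST; first by move->; rewrite inE.
    by exists (dart_rev d); rewrite ?dart_revK ?inE.
  rewrite (dart_count (fun x y => (y \in S) && (x \in T))) [leqRHS]big_mkcond.
  apply: leq_sum => v _; case: ifP => vT.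
    by apply: subset_leq_card; apply/subsetP => y; rewrite !inE ?vT ?andbT.
  rewrite leqn0 cards_eq0; apply/eqP/setP => y; by rewrite !inE ?vT ?andbF.
have sub : odd_classes (~: X) k \subset O1 :|: O2 :|: I.
  apply/subsetP => i; rewrite !in_setU -implyNb => iO; apply/implyP.
  rewrite negb_or => /andP[iO1 iO2].
  (* Swapping copies and reversing darts not incident with [T] pairs off a class; its fixed points
     are the darts into [T], so these decide the parity of the class. *)
  pose phi (u : (G * bool) + dart) := match u with
    | inl p => inl (p.1, ~~ p.2)
    | inr d => if ((val d).1 \in T) || ((val d).2 \in T) then inr d else inr (dart_rev d)
    end.
  have phiK : involutive phi.
    case=> [[v b]|d] /=; first by rewrite negbK.
    case: ifP => dT /=; first by rewrite dT.
    by rewrite orbC dT dart_revK.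
  pose A := [set u in ~: X | k u == i].
  have phiA u : u \in A -> phi u \in A.
    case: u => [[v b]|d] /=; rewrite !inE.
      move=> /andP[]; rewrite !SX => vS /eqP ki.
      have vR : v \in R.
        rewrite in_setC in_setU (negPf vS) /=; apply: contra iO1 => vT.
        by apply/imsetP; exists (v, b); rewrite // !inE vT.
      by rewrite vS kRE // -(kRE v b) // ki eqxx.
    move=> /andP[dX /eqP ki]; case: ifP => [_|/norP[d1 d2]]; first by rewrite dX ki eqxx.
    have rX : inr (dart_rev d) \notin X by rewrite TX.
    by rewrite rX -ki -(sepk (inr d) (inr (dart_rev d))) //= ?eqxx.
  move: iO; rewrite inE -/A (odd_card_involutive phiK phiA) inE.
  pose B := [set d : dart | ((val d).1 \in label_class R kR i) && ((val d).2 \in T)].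
  have -> : [set u in A | phi u == u] = [set inr d | d in B].
    apply/setP => u; apply/idP/imsetP => [|[d]].
      case: u => [[v b]|d]; rewrite !inE /=.
        by rewrite andbC => /andP[/eqP[]]; case: b.
      move=> /andP[/andP[dX /eqP ki]].
      have d1T : (val d).1 \notin T by rewrite -TX.
      rewrite (negPf d1T) /=; case: (boolP ((val d).2 \in T)) => d2T /=; last first.
        by move/eqP=> [] /(congr1 val) E; case/eqP: (dart_rev_neq d); apply: val_inj.
      move=> _; exists d => //.
      have d1R : (val d).1 \in R.
        rewrite in_setC in_setU (negPf d1T) orbF; apply: contra iO2 => d1S.
        by apply/imsetP; exists d; rewrite // inE d1S.
      by rewrite inE d2T andbT inE d1R -(proj2 (kRd d d1R)) ki eqxx.
    move=> dB ->; move: dB; rewrite [d \in B]inE => /andP[dC d2T].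
    move: dC; rewrite [_ \in label_class _ _ _]inE => /andP[d1R /eqP kd].
    have [dX dk] := kRd d d1R.
    by rewrite inE /= d2T orbT eqxx andbT inE in_setC dX dk kd eqxx.
  rewrite (card_imset _ inr_inj) (dart_count (fun x y => (x \in label_class R kR i) && (y \in T))).
  congr odd; rewrite [RHS]big_mkcond; apply: eq_bigr => v _; case: ifP => vR.
    by apply: eq_card => y; rewrite !inE.
  by apply/eqP; rewrite cards_eq0; apply/eqP/setP => y; rewrite !inE ?vR ?andbF.
have := leq_trans oddk (leq_trans (subset_leq_card sub)
  (leq_trans (leq_card_setU _ _).1 (leq_add (leq_card_setU O1 O2).1 (leqnn #|I|)))).
have -> : \sum_(y in T) #|nbh y :\: S| = \sum_(y in T) #|nbh y| - \sum_(y in T) #|nbh y :&: S|.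
  rewrite -sumnB => [|y _]; last by rewrite subset_leq_card ?subsetIl.
  by apply: eq_bigr => y _; rewrite -[X in X - _](cardsID S (nbh y)) addKn.
have : \sum_(y in T) #|nbh y :&: S| <= \sum_(y in T) #|nbh y|.
  by apply: leq_sum => y _; rewrite subset_leq_card ?subsetIl.
rewrite -/R -/I cX; move: cO1 cO2; move: #|O1| #|O2| #|I|; lia.
Qed.
End Gadget.

Lemma odd_sum (I : finType) (A : {set I}) (F : I -> nat) :
  odd (\sum_(i in A) F i) = odd #|[set i in A | odd (F i)]|.
Proof.
have -> : #|[set i in A | odd (F i)]| = \sum_(i in A) odd (F i).
  rewrite -sum1_card big_mkcond [RHS]big_mkcond; apply: eq_bigr => i _.
  by rewrite inE; case: (i \in A); case: (odd (F i)).
by elim/big_rec2: _ => // i m n _ E; rewrite !oddD E oddb.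
Qed.

(** * Components, barriers and their parity *)

Section Components.
Variable G : sgraph.
Implicit Types (W A C S T : {set G}) (x y z : G).

Definition in_rel W : rel G := fun x y => [&& x \in W, y \in W & edge x y].

Definition comp W x : {set G} := [set y | connect (in_rel W) x y].

Lemma in_rel_csym W : connect_sym (in_rel W).
Proof.
by apply: sym_connect_sym => x y; rewrite /in_rel andbCA edge_sym.
Qed.

Lemma mem_comp W x : x \in comp W x.
Proof. by rewrite inE connect0. Qed.

Lemma comp_eq W x y : (y \in comp W x) = (comp W x == comp W y).
Proof.
apply/idP/eqP => [xy|->]; last exact: mem_comp.
apply/setP => z; rewrite !inE; rewrite inE in xy.
apply/idP/idP; last exact: connect_trans xy.
by apply: connect_trans; rewrite in_rel_csym.
Qed.

Lemma comp_closed W A x : x \in A ->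
  (forall y z, y \in A -> y \in W -> z \in W -> edge y z -> z \in A) -> comp W x \subset A.
Proof.
move=> xA cl; apply/subsetP => z; rewrite inE => /connectP[p + ->].
elim: p x xA => [|y p IH] x xA //= /andP[/and3P[xW yW exy]].
by apply: IH; apply: cl xA xW yW exy.
Qed.

Lemma comp_sub W x : x \in W -> comp W x \subset W.
Proof. by move=> xW; apply: comp_closed. Qed.

Lemma comp_out W x : x \notin W -> comp W x = [set x].
Proof.
move=> xW; apply/eqP; rewrite eqEsubset sub1set mem_comp andbT.
by apply: comp_closed => [|y z /set1P -> yW]; [exact: set11 | rewrite yW in xW].
Qed.

Lemma comp_edge W x y : x \in W -> y \in W -> edge x y -> comp W x = comp W y.
Proof.
by move=> xW yW exy; apply/eqP; rewrite -comp_eq inE connect1 // /in_rel xW yW.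
Qed.

Lemma sum_comps W A (f : G -> nat) : (forall x, x \in A -> comp W x \subset A) ->
  \sum_(v in A) f v = \sum_(C in comp W @: A) \sum_(v in C) f v.
Proof.
move=> cl; rewrite (partition_big (comp W) (mem (comp W @: A))) /=; last first.
  by move=> v vA; apply: imset_f.
apply: eq_bigr => _ /imsetP[x xA ->]; apply: eq_bigl => v.
rewrite [RHS]comp_eq eq_sym andb_idl // -comp_eq; exact: (subsetP (cl _ xA)).
Qed.

Definition deg_to T C := \sum_(v in C) #|nbh v :&: T|.

Definition odd_comps S T : {set {set G}} :=
  [set C in comp (~: (S :|: T)) @: ~: (S :|: T) | odd (deg_to T C)].

Definition barrier S T := [disjoint S & T] &&
  (2 * #|S| + \sum_(y in T) #|nbh y :\: S| + 2 <= 2 * #|T| + #|odd_comps S T|).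

(** Both sides count, modulo 2, the edges between [T] and the rest outside [S]: edges inside [T] are
    counted twice on the left, and the reversal [phi] cancels them. *)
Lemma odd_barrier_sum S T : [disjoint S & T] ->
  odd (\sum_(y in T) #|nbh y :\: S|) = odd #|odd_comps S T|.
Proof.
move=> ST; rewrite -odd_sum -sum_comps; last exact: comp_sub.
have dE (A B : {set G}) : \sum_(y in A) #|nbh y :&: B| =
    #|[set d : dart G | ((val d).1 \in A) && ((val d).2 \in B)]|.
  rewrite (dart_count (fun x y => (x \in A) && (y \in B))) big_mkcond; apply: eq_bigr => v _.
  case: ifP => vA; first by apply: eq_card => y; rewrite !inE.
  by apply/esym/eqP; rewrite cards_eq0; apply/eqP/setP => y; rewrite !inE andbF.
have -> : \sum_(y in T) #|nbh y :\: S| = \sum_(y in T) #|nbh y :&: ~: S|.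
  by apply: eq_bigr => y _; rewrite setDE.
rewrite !dE.
pose phi (d : dart G) := if ((val d).1 \in T) && ((val d).2 \in T) then dart_rev d else d.
have phiK : involutive phi.
  move=> d; rewrite /phi; case E: (((val d).1 \in T) && _) => /=; last by rewrite E.
  by rewrite andbC E dart_revK.
rewrite (odd_card_involutive phiK); last first.
  move=> d; rewrite !inE /phi => /andP[dT dS]; case: ifP => [/andP[_ d2T]|_]; last by rewrite dT.
  by rewrite /= d2T; apply/negP => dS'; move/disjointFr: ST => /(_ _ dS'); rewrite dT.
congr odd; rewrite -[RHS](card_imset _ (can_inj (@dart_revK G))); apply: eq_card => d.
apply/idP/imsetP => [|[d']].
  rewrite !inE => /andP[/andP[d1 d2]]; rewrite /phi d1 /=; case: ifP => d2T.
    by rewrite (negPf (dart_rev_neq d)).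
  by move=> _; exists (dart_rev d); rewrite ?dart_revK // !inE /= d1 d2T orbF andbT.
rewrite !inE => /andP[]; rewrite negb_or => /andP[d1S d1T] d2T ->.
by rewrite /= d2T d1S /phi /= (negPf d1T) andbF eqxx.
Qed.

(** Label classes are unions of components, and a class with odd degree to [T] contains an odd
    component, so passing to components loses nothing. Parity then improves the strict inequality to
    the slack 2 in [barrier]. *)
Theorem two_factor_or_barrier : has_two_factor G \/ exists S T, barrier S T.
Proof.
have [|[S [T [L [k [ST sepk bar]]]]]] := two_factor_or_labels G; first by left.
right; exists S, T; rewrite /barrier ST /=; set W := ~: (S :|: T) in sepk bar *.
have {}sepk x y : x \in W -> y \in W -> edge x y -> k x = k y.
  by rewrite !in_setC; apply: sepk.
have kcomp x : x \in W -> comp W x \subset label_class W k (k x).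
  move=> xW; apply: comp_closed => [|y z]; first by rewrite inE xW eqxx.
  rewrite inE => /andP[yW /eqP <-] _ zW eyz; rewrite inE zW /= eq_sym; apply/eqP; exact: sepk.
set I := [set i | _] in bar.
have Sinj : injective (@Some L) by move=> i j [].
have le : #|I| <= #|odd_comps S T|.
  rewrite -(card_imset _ Sinj).
  apply: leq_trans (leq_imset_card (fun C : {set G} => omap k [pick x in C]) _).
  apply: subset_leq_card; apply/subsetP => _ /imsetP[i + ->].
  rewrite inE (@sum_comps W) => [|x]; last by rewrite inE => /andP[xW /eqP <-]; apply: kcomp.
  rewrite odd_sum; set O := [set C in _ | _] => oddO.
  have /set0Pn[C] : O != set0 by apply: contraL oddO => /eqP ->; rewrite cards0.
  rewrite inE => /andP[/imsetP[x]]; rewrite inE => /andP[xW /eqP xi] CE oddC.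
  apply/imsetP; exists C; first by rewrite inE CE imset_f // -CE.
  case: pickP => [y|/(_ x)]; last by rewrite CE mem_comp.
  by rewrite CE => /(subsetP (kcomp x xW)); rewrite inE xi => /andP[_ /eqP <-].
have := odd_barrier_sum ST; set a := \sum_(y in T) _; set b := #|odd_comps _ _| in le *.
move=> par; have {}bar := leq_trans bar (leq_add (leqnn _) le).
clear -par bar; move: bar; rewrite leq_eqVlt => /orP[/eqP E|]; last by lia.
have : odd (2 * #|S| + a).+1 = odd (2 * #|T| + b) by rewrite E.
by rewrite oddS !oddD !addbA !addbb par; case: (odd b).
Qed.

End Components.

(** * Extremal barriers *)

Section Biased.
Variable G : sgraph.
Implicit Types (W A C S T : {set G}) (x y z : G).

Definition biased S T := [/\ barrier S T,
  forall S' T', barrier S' T' -> #|S'| <= #|S| & forall T', barrier S T' -> #|T| <= #|T'| ].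

Lemma exists_biased : (exists S T, barrier S T) -> exists S T, biased S T.
Proof.
move=> [S0 [T0 bar0]].
case: (@arg_maxnP _ (S0, T0) (fun p => barrier p.1 p.2) (fun p => #|p.1|) bar0).
move=> [S T1] /= bar1 Smax.
case: (@arg_minnP _ T1 (barrier S) (fun T => #|T|) bar1) => T bar Tmin.
by exists S, T; split=> // S' T' bar'; apply: (Smax (S', T')).
Qed.

Lemma sum_nbh_sym A B : \sum_(v in A) #|nbh v :&: B| = \sum_(y in B) #|nbh y :&: A|.
Proof.
have E (A' B' : {set G}) : \sum_(v in A') #|nbh v :&: B'| = \sum_(v in A') \sum_(y in B') edge v y.
  apply: eq_bigr => v _; rewrite -sum1_card big_mkcond [RHS]big_mkcond.
  by apply: eq_bigr => y _; rewrite !inE andbC; case: (y \in B'); case: edge.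
by rewrite !E exchange_big; do 2!(apply: eq_bigr => ? _); rewrite edge_sym.
Qed.

Lemma comp_change W W' z : z \in W -> comp W z \subset W' ->
  (forall u v, u \in comp W z -> v \in W' -> edge u v -> v \in W) -> comp W' z = comp W z.
Proof.
move=> zW sW cl; have step u v : u \in comp W z -> u \in W -> v \in W -> edge u v ->
    v \in comp W z.
  by rewrite !comp_eq => /eqP -> uW vW euv; apply/eqP/comp_edge.
apply/eqP; rewrite eqEsubset; apply/andP; split.
  apply: comp_closed (mem_comp _ _) _ => u v uC _ vW' euv.
  by apply: step (euv) => //; [apply: (subsetP (comp_sub zW)) | apply: cl euv].
have : comp W z \subset comp W z :&: comp W' z; last by rewrite subsetI => /andP[].
apply: comp_closed; first by rewrite inE !mem_comp.
move=> u v /setIP[uC uC'] uW vW euv; have vC := step u v uC uW vW euv.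
rewrite inE vC; move: uC'; rewrite !comp_eq => /eqP ->; apply/eqP.
by apply: comp_edge euv; apply: (subsetP sW).
Qed.

Lemma comp_mono W W' x : W \subset W' -> comp W x \subset comp W' x.
Proof.
move=> sW; apply: comp_closed (mem_comp W' x) _ => y z.
rewrite comp_eq => /eqP -> yW zW eyz; rewrite comp_eq; apply/eqP.
by apply: comp_edge => //; apply: (subsetP sW).
Qed.

Lemma barrier_parity (s t a b : nat) : odd a = odd b ->
  ~~ (2 * s + a + 2 <= 2 * t + b) -> 2 * t + b <= 2 * s + a.
Proof.
move=> par; rewrite -(odd_double_half a) -(odd_double_half b) par -!muln2.
move: (nat_of_bool (odd b)) => c; lia.
Qed.

Variables S T : {set G}.
Hypothesis biST : biased S T.
Let W := ~: (S :|: T).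

Definition tnbr C : {set G} := [set y in T | [exists z in C, edge y z]].

Lemma biased_disjoint : [disjoint S & T].
Proof. by case: biST => /andP[]. Qed.

Lemma odd_comp_sub C : C \in odd_comps S T -> C \subset W.
Proof. by rewrite inE => /andP[/imsetP[x xW ->] _]; apply: comp_sub. Qed.

Lemma odd_comp_eq C x : C \in odd_comps S T -> x \in C -> comp W x = C.
Proof.
by rewrite inE => /andP[/imsetP[z zW ->] _]; rewrite comp_eq => /eqP.
Qed.

(** By minimality of [T], dropping [y] destroys the barrier. Odd components not adjacent to [y]
    survive, so at least as many odd components touch [y] as [y] has neighbours outside [S]. Hence
    each such neighbour lies in an odd component of its own. *)
Lemma barrier_vertex y : y \in T ->
  {in nbh y :\: S &, injective (comp W)} /\
  (forall z, z \in nbh y :\: S -> comp W z \in odd_comps S T).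
Proof.
move=> yT; have [bar Smax Tmin] := biST; have ST := biased_disjoint.
have ST' : [disjoint S & T :\ y] by apply: disjointWr ST; apply: subsetDl.
have cT : #|T| = #|T :\ y|.+1 by rewrite (cardsD1 y) yT.
pose N := nbh y :\: S; pose O := odd_comps S T.
pose O1 := [set C in O | [exists z in C, edge y z]].
have sub0 : O :\: O1 \subset odd_comps S (T :\ y).
  apply/subsetP => C; rewrite in_setD [C \in O1]inE => /andP[nC CO].
  move: nC; rewrite CO negb_exists_in => /forall_inP nC.
  have CW := odd_comp_sub CO; move: (CO); rewrite inE => /andP[/imsetP[x xW CE] oddC].
  have WW' : W \subset ~: (S :|: T :\ y).
    by rewrite setCS; apply: setUS; apply: subsetDl.
  rewrite inE; apply/andP; split.
    apply/imsetP; exists x; first exact: (subsetP WW').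
    rewrite CE; apply/esym/comp_change => //; rewrite -CE; first exact: subset_trans WW'.
    move=> u z uC zW' euz; move: zW'; rewrite !inE; case: (eqVneq z y) => // zy.
    by have := nC u uC; rewrite edge_sym -zy euz.
  rewrite (_ : deg_to (T :\ y) C = deg_to T C) //; apply: eq_bigr => v vC.
  apply: eq_card => z; rewrite !inE; case: (eqVneq z y) => //= ->.
  by rewrite edge_sym (negPf (nC v vC)).
have h' : #|O| - #|O1| <= #|odd_comps S (T :\ y)|.
  apply: leq_trans (subset_leq_card sub0); rewrite cardsD leq_sub2l //.
  by apply: subset_leq_card; apply: subsetIr.
have nbar : ~~ barrier S (T :\ y).
  by apply/negP => /Tmin; rewrite cT ltnn.
move: nbar; rewrite /barrier ST' /= => /(barrier_parity (odd_barrier_sum ST')).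
have := proj2 (andP bar); rewrite (big_setD1 y) //= cT -/O -/N.
have sub1 : O1 \subset comp W @: N.
  apply/subsetP => C; rewrite inE => /andP[CO /exists_inP[z zC eyz]].
  apply/imsetP; exists z; last by rewrite (odd_comp_eq CO zC).
  rewrite !inE eyz andbT; have := subsetP (odd_comp_sub CO) _ zC.
  by rewrite !inE => /norP[].
have := subset_leq_card sub1; have := leq_imset_card (comp W) N.
move=> c1 c2 c3 c4.
have cO1 : #|N| <= #|O1|.
  move: h' c3 c4; move: #|odd_comps _ _| #|O| #|O1| #|N| #|T :\ y| (\sum_(i in _) _); lia.
split.
  apply/imset_injP; rewrite eqn_leq c1; exact: leq_trans cO1 c2.
have /eqP O1E : O1 == comp W @: N by rewrite eqEcard sub1 (leq_trans c1).
move=> z zN; have : comp W z \in O1 by rewrite O1E imset_f.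
by rewrite inE => /andP[].
Qed.

(** Moving [x] into [S] costs 2 and saves the edges from [x] to [T]. By maximality of [S] the result
    is no barrier, and by parity it has no slack at all. *)
Lemma barrier_rest x : x \in W ->
  #|nbh x :&: T| + #|odd_comps (x |: S) T| <= #|odd_comps S T|.
Proof.
move=> xW; have [bar Smax Tmin] := biST; have ST := biased_disjoint.
have [xS xT] : x \notin S /\ x \notin T by apply/norP; move: xW; rewrite !inE.
have ST' : [disjoint x |: S & T] by rewrite -setI_eq0 setIUl setU_eq0 !setI_eq0 disjoints1 xT.
have nbar : ~~ barrier (x |: S) T.
  by apply/negP => /Smax; rewrite cardsU1 xS ltnn.
move: nbar; rewrite /barrier ST' /= => /(barrier_parity (odd_barrier_sum ST')).
have E : \sum_(y in T) #|nbh y :\: S| = \sum_(y in T) #|nbh y :\: (x |: S)| + #|nbh x :&: T|.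
  have -> : #|nbh x :&: T| = \sum_(y in T) #|nbh y :&: [set x]|.
    by rewrite -sum_nbh_sym big_set1.
  rewrite -big_split /=; apply: eq_bigr => y _.
  rewrite -(cardsID [set x] (nbh y :\: S)) addnC setDDl [S :|: _]setUC.
  congr (_ + #|pred_of_set _|).
  apply/setP => z; rewrite !inE; case: (eqVneq z x) => [->|]; rewrite ?andbF //.
  by rewrite xS.
have := proj2 (andP bar); rewrite E cardsU1 xS /=; lia.
Qed.

Lemma odd_comps_rest x : x \in W ->
  odd_comps S T :\ comp W x \subset odd_comps (x |: S) T.
Proof.
move=> xW; apply/subsetP => C; rewrite in_setD1 => /andP[Cx CO].
have CW := odd_comp_sub CO; move: (CO); rewrite inE => /andP[/imsetP[z zW CE] oddC].
have WE : ~: ((x |: S) :|: T) = W :\ x by rewrite -setUA setCU setIC -setDE.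
have xC : x \notin C by apply: contra Cx => /(odd_comp_eq CO) ->.
rewrite inE oddC andbT WE; apply/imsetP; exists z.
  rewrite in_setD1 zW andbT; apply: contraNneq xC => <-; by rewrite CE mem_comp.
rewrite CE; apply/esym/comp_change => //; rewrite -CE.
  by rewrite subsetD1 CW.
by move=> u v _; rewrite in_setD1 => /andP[].
Qed.

Lemma barrier_rest_le1 x : x \in W -> #|nbh x :&: T| <= 1.
Proof.
move=> xW; have := barrier_rest xW; have := subset_leq_card (odd_comps_rest xW).
rewrite (cardsD1 (comp W x) (odd_comps S T)); case: (_ \in odd_comps S T) => /=;
  move: #|_ :\ _| #|odd_comps _ _| #|_ :&: _|; lia.
Qed.

(** A [T]-neighbour of [x] forces the number of odd components to drop by one when [x] is moved to
    [S]. All odd components other than that of [x] survive, so no piece left of it can be odd. *)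
Lemma barrier_rest_even x z : x \in W -> nbh x :&: T != set0 ->
  z \in comp W x -> z != x -> ~~ odd (deg_to T (comp (W :\ x) z)).
Proof.
move=> xW xT zx nzx; apply/negP => oddz.
have zW : z \in W by apply: (subsetP (comp_sub xW)).
have WE : ~: ((x |: S) :|: T) = W :\ x by rewrite -setUA setCU setIC -setDE.
have zO : comp (W :\ x) z \in odd_comps (x |: S) T.
  by rewrite inE WE oddz andbT imset_f // in_setD1 nzx.
have nO : comp (W :\ x) z \notin odd_comps S T :\ comp W x.
  apply/negP; rewrite in_setD1 => /andP[ne zO']; case/eqP: ne.
  by rewrite -(odd_comp_eq zO' (mem_comp _ _)); apply/eqP; rewrite eq_sym -comp_eq.
have := barrier_rest xW; have : 0 < #|nbh x :&: T| by rewrite card_gt0.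
have : #|odd_comps S T :\ comp W x| < #|odd_comps (x |: S) T|.
  apply: proper_card; apply/properP; split; first exact: odd_comps_rest.
  by exists (comp (W :\ x) z).
rewrite (cardsD1 (comp W x) (odd_comps S T)); case: (_ \in odd_comps S T) => /=;
  move: #|_ :\ _| #|odd_comps _ _| #|_ :&: _|; lia.
Qed.

(** A vertex of [T] has at most one neighbour in a component, so edges into [K] and attached
    vertices are equinumerous. Stated for parts of components because of the pieces left by a
    deleted vertex. *)
Lemma deg_toE (K : {set G}) x : x \in W -> K \subset comp W x -> deg_to T K = #|tnbr K|.
Proof.
move=> xW KC; rewrite /deg_to sum_nbh_sym -sum1_card [RHS]big_mkcond [LHS]big_mkcond.
apply: eq_bigr => y _; rewrite inE; case: ifP => //= yT.
case: ifP => [/exists_inP[z zK eyz]|/negbT]; last first.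
  rewrite negb_exists_in => /forall_inP nK; apply/eqP; rewrite cards_eq0.
  by apply/eqP/setP => z; rewrite !inE andbC; case zK: (z \in K) => //=; apply/negbTE/nK.
have [inj _] := barrier_vertex yT.
apply/eqP/cards1P; exists z; apply/setP => u; rewrite !inE.
apply/andP/eqP => [[eyu uK]|->//]; have KW v : v \in K -> v \notin S.
  by move=> /(subsetP KC)/(subsetP (comp_sub xW)); rewrite !inE => /norP[].
have KE v : v \in K -> comp W x = comp W v.
  by move=> /(subsetP KC); rewrite comp_eq => /eqP.
by apply: inj; rewrite ?inE ?KW // -(KE u uK) -(KE z zK).
Qed.

Lemma tnbr_odd C : C \in odd_comps S T -> odd #|tnbr C|.
Proof.
rewrite inE => /andP[/imsetP[x xW ->] oddC].
by rewrite -(@deg_toE _ x xW).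
Qed.

Lemma mem_tnbr y x : y \in T -> x \in W -> edge y x ->
  comp W x \in odd_comps S T /\ y \in tnbr (comp W x).
Proof.
move=> yT xW eyx; split.
  by apply: (proj2 (barrier_vertex yT)); move: xW; rewrite !inE eyx andbT => /norP[].
by rewrite inE yT; apply/exists_inP; exists x; rewrite ?mem_comp.
Qed.

(** A neighbour in [T] would have to lie in an odd component, but [comp W z] is the singleton of [z]
    outside [W]. *)
Lemma barrier_indep y z : y \in T -> z \in T -> ~~ edge y z.
Proof.
move=> yT zT; apply/negP => eyz; have [_ /(_ z)] := barrier_vertex yT.
have zS : z \notin S by rewrite (disjointFl biased_disjoint zT).
rewrite !inE eyz zS comp_out ?inE ?zT ?orbT // => /(_ isT) /andP[/imsetP[x xW zE] _].
have := comp_sub xW; rewrite /= -zE sub1set => zW.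
by move: zW; rewrite !inE zT orbT.
Qed.

Lemma card_nbh_comps y : y \in T ->
  #|nbh y :\: S| = \sum_(C in odd_comps S T) (y \in tnbr C).
Proof.
move=> yT; have [inj cO] := barrier_vertex yT.
rewrite -(card_in_imset inj) -sum1_card big_mkcond [RHS]big_mkcond; apply: eq_bigr => C _.
case: ifP => [/imsetP[z zN CE]|nC].
  rewrite CE cO //; move: zN; rewrite !inE => /andP[_ eyz]; rewrite yT /=.
  by case: exists_inP => // -[]; exists z; rewrite ?mem_comp.
case: ifP => // CO; rewrite inE yT; case: exists_inP => //= -[z zC eyz].
move/negP: nC; case; apply/imsetP; exists z; last by rewrite (odd_comp_eq CO zC).
by rewrite !inE eyz andbT; have := subsetP (odd_comp_sub CO) _ zC; rewrite !inE => /norP[].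
Qed.

Lemma sum_tnbr : \sum_(y in T) #|nbh y :\: S| = \sum_(C in odd_comps S T) #|tnbr C|.
Proof.
rewrite (eq_bigr _ card_nbh_comps) exchange_big; apply: eq_bigr => C _ /=.
rewrite -sum1_card big_mkcond [RHS]big_mkcond; apply: eq_bigr => y _.
by case: ifP => yT; rewrite inE yT //=; case: [exists _ in _, _].
Qed.

Definition big_comps : {set {set G}} := [set C in odd_comps S T | 2 < #|tnbr C|].

(** An odd component that is not big has exactly one attachment, its number being odd and at most 2;
    it contributes 1 to both sides and cancels. *)
Lemma barrier_count :
  2 * #|S| + \sum_(C in big_comps) #|tnbr C| + 2 <= 2 * #|T| + #|big_comps|.
Proof.
have [/andP[_ bar] _ _] := biST; move: bar.
rewrite sum_tnbr (big_setID big_comps) /= -(cardsID big_comps (odd_comps S T)).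
have -> : odd_comps S T :&: big_comps = big_comps.
  by apply/setIidPr; apply/subsetP => C; rewrite inE => /andP[].
have -> : \sum_(C in odd_comps S T :\: big_comps) #|tnbr C| = #|odd_comps S T :\: big_comps|.
  rewrite -sum1_card; apply: eq_bigr => C; rewrite in_setD => /andP[+ CO].
  by rewrite inE CO /= -leqNgt; have := tnbr_odd CO; case: #|tnbr C| => [|[|[]]].
move: #|odd_comps _ _ :\: _| #|big_comps|; lia.
Qed.
End Biased.

(** * Induced paths *)

Section InducedPaths.
Variable G : sgraph.
Implicit Types (s t p : seq G) (x y u v d : G).

Fixpoint ipath s : bool :=
  if s is x :: s' then
    [&& x \notin s', if s' is y :: s'' then edge x y && ~~ has (edge x) s'' else true & ipath s']
  else true.

Lemma ipath_uniq s : ipath s -> uniq s.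
Proof. by elim: s => //= x s IH /and3P[-> _ /IH]. Qed.

Lemma ipath_catr s t : ipath (s ++ t) -> ipath t.
Proof. by elim: s => //= x s IH /and3P[_ _ /IH]. Qed.

Lemma ipath_take n s : ipath s -> ipath (take n s).
Proof.
elim: s n => [|x s IH] [|n] //= /and3P[xs h ips]; rewrite IH // andbT; apply/andP; split.
  by apply: contra xs; apply: mem_take.
case: s h {IH ips xs} => [|y s] // ; case: n => [|n] //= /andP[-> nh] /=.
by apply: contra nh => /hasP[z /mem_take zs xz]; apply/hasP; exists z.
Qed.

Lemma ipath_cat d s t : ipath s -> ipath t -> s != [::] -> t != [::] ->
  (forall u v, u \in s -> v \in t ->
     u != v /\ edge u v = (u == last d s) && (v == head d t)) ->
  ipath (s ++ t).
Proof.
elim: s => [//|x s IH] /= /and3P[xs h ips] ipt _ tn cr.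
have crx v : v \in t -> x != v /\ edge x v = (x == last x s) && (v == head d t).
  by move=> vt; apply: cr; rewrite // inE eqxx.
have xt : x \notin t by apply/negP => /crx[]; rewrite eqxx.
rewrite mem_cat negb_or xs xt /=.
case: s IH xs h ips cr crx => [|y s] IH xs h ips cr crx /=.
  case: t tn ipt xt crx {IH cr} => [//|z t] _ ipt xt crx.
  apply/andP; split; last exact: ipt.
  have [_ ->] := crx z (mem_head _ _); rewrite !eqxx /=.
  apply/hasPn => w wt; have [|_ ->] := crx w; first by rewrite inE wt orbT.
  by rewrite eqxx /=; move: ipt => /= /andP[zt _]; apply: contraNneq zt => <-.
case/andP: h => -> nh /=; apply/andP; split.
  rewrite has_cat negb_or nh /=; apply/hasPn => w /crx[_ ->].
  rewrite /= (_ : (x == _) = false) //; apply: contraNF xs => /eqP xl.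
  by rewrite xl mem_last.
apply: IH => // u v us vt; apply: cr => //; by rewrite inE us orbT.
Qed.

Lemma ipath_rev s : ipath s -> ipath (rev s).
Proof.
elim: s => //= x s IH /and3P[xs h ips]; rewrite rev_cons -cats1.
case: s IH xs h ips => [|y s] IH xs h ips //.
apply: (@ipath_cat x) => //; [exact: IH | by rewrite -size_eq0 size_rev |].
move=> u v; rewrite mem_rev mem_seq1 => us /eqP ->; split.
  by apply: contraNneq xs => <-.
rewrite rev_cons last_rcons eqxx andbT edge_sym; case/andP: h => exy nh.
move: us; rewrite inE => /predU1P[->|us]; first by rewrite eqxx exy.
rewrite (negPf (hasPn nh u us)); apply/esym; apply: contraTF ips => /eqP uy /=.
by rewrite -uy us.
Qed.

Lemma split_last_has (X : eqType) (P : pred X) (s : seq X) : has P s ->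
  exists (s1 : seq X) (w : X) (s2 : seq X), [/\ s = s1 ++ w :: s2, P w & ~~ has P s2].
Proof.
elim: s => //= x s IH; case: (boolP (has P s)) => [hs _|ns].
  by have [s1 [w [s2 [-> Pw nP]]]] := IH hs; exists (x :: s1), w, s2.
by rewrite orbF => Px; exists [::], x, s.
Qed.

(** Shortcut from the front: [x] is joined to its last neighbour on an induced path already
    extracted from the tail. *)
Lemma ipath_of_path x p : path (@edge G) x p -> uniq (x :: p) ->
  exists q, [/\ ipath (x :: q), last x q = last x p & {subset x :: q <= x :: p}].
Proof.
elim: p x => [|y p IH] x; first by move=> _ _; exists [::]; split.
move=> /= /andP[exy pth] /andP[xyp unp]; have [q [ipq lq sq]] := IH y pth unp.
have hq : has (edge x) (y :: q) by rewrite /= exy.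
have [s1 [w [s2 [qE xw nh]]]] := split_last_has hq.
have sub : {subset w :: s2 <= y :: p}.
  by move=> u us; apply: sq; rewrite qE mem_cat us orbT.
exists (w :: s2); split.
- apply/and3P; split; [by apply: contra xyp => /sub | by rewrite xw nh |].
  by move: ipq; rewrite qE => /ipath_catr.
- by rewrite /= -lq -[last y q]/(last y (y :: q)) qE last_cat.
- by move=> u; rewrite inE => /predU1P[->|/sub us]; rewrite inE ?eqxx // us orbT.
Qed.

(** Start at the last vertex satisfying [P] and stop at the first one satisfying [Q] from there
    on. *)
Lemma path_trim (e : rel G) (P Q : pred G) x p : path e x p -> P x -> Q (last x p) ->
  exists x' p', [/\ path e x' p', {subset x' :: p' <= x :: p}, P x', Q (last x' p') &
    ~~ has P p' /\ ~~ has Q (belast x' p')].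
Proof.
move=> pth Px Ql; have hP : has P (x :: p) by rewrite /= Px.
have [s1 [w [s2 [pE Pw nP]]]] := split_last_has hP.
have lE : last w s2 = last x p by rewrite -[RHS]/(last x (x :: p)) pE last_cat.
have pth2 : path e w s2.
  case: s1 pE => [|z s1] /= [E1 E2]; first by rewrite -E1 -E2.
  by move: pth; rewrite E2 cat_path => /andP[_ /= /andP[]].
have sub : {subset w :: s2 <= x :: p} by move=> u us; rewrite pE mem_cat us orbT.
rewrite -lE in Ql; case: (boolP (Q w)) => Qw.
  by exists w, [::]; split=> // u; rewrite mem_seq1 => /eqP ->; apply: sub; rewrite mem_head.
have hQ : has Q s2.
  apply/hasP; exists (last w s2) => //; have := mem_last w s2.
  by rewrite inE => /predU1P[lw|//]; move: Qw; rewrite -lw Ql.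
move: pth2 nP sub; case/split_find: hQ => z s3 s4 Qz nQ.
rewrite cat_path has_cat negb_or => /andP[pth3 _] /andP[nP3 _] sub.
exists w, (rcons s3 z); split; rewrite ?last_rcons //.
  by move=> u us; apply: sub; rewrite -cat_cons mem_cat us.
by rewrite belast_rcons /= negb_or Qw.
Qed.

Lemma ipath_edge s x y : ipath s -> x \in s -> y \in s ->
  edge x y = ((index x s).+1 == index y s) || ((index y s).+1 == index x s).
Proof.
elim: s => //= z s IH /and3P[zs h ips].
have first w : w \in s -> edge z w = (index w s == 0).
  case: s h ips {zs IH} => [//|t s] /andP[ezt nh] ips; rewrite inE => /predU1P[->|ws].
    by rewrite ezt /= eqxx.
  rewrite (negPf (hasPn nh w ws)) /=; case: (eqVneq t w) => // tw.
  by move: ips; rewrite /= tw ws.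
rewrite !inE; case: (eqVneq z x) => [<-|zx]; case: (eqVneq z y) => [<-|zy] //=.
- by rewrite edge_irrefl.
- by move=> _ ys; rewrite first //; case: (index y s) => [|[]].
- by move=> xs _; rewrite edge_sym first //; case: (index x s) => [|[]].
by move=> xs ys; rewrite IH.
Qed.
End InducedPaths.

Lemma induced_disjoint_paths (G : sgraph) m n (s t : seq G) :
  ipath s -> ipath t -> size s = m.+1 -> size t = n.+1 ->
  (forall u v, u \in s -> v \in t -> u != v /\ ~~ edge u v) ->
  exists U : {set G}, isomorphic (induced U) (disjoint_union (path_graph m.+1) (path_graph n.+1)).
Proof.
move=> ips ipt sm tn cr; pose U := [set u in s ++ t]; exists U.
have cU : #|U| = m.+1 + n.+1.
  rewrite cardsE (card_uniqP _) ?size_cat ?sm ?tn // cat_uniq !ipath_uniq //= andbT.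
  by apply/hasPn => v vt; apply/negP => vs; have [] := cr v v vs vt; rewrite eqxx.
pose f (u : induced U) : disjoint_union (path_graph m.+1) (path_graph n.+1) :=
  if val u \in s then inl (inord (index (val u) s)) else inr (inord (index (val u) t)).
have ut (u : induced U) : val u \notin s -> val u \in t.
  by have := valP u; rewrite inE mem_cat => /orP[->|].
have is_ x : x \in s -> index x s < m.+1 by rewrite -sm index_mem.
have it x : x \in t -> index x t < n.+1 by rewrite -tn index_mem.
have finj : injective f.
  move=> u v; rewrite /f; case: ifPn => us; case: ifPn => vs //.
    move=> [] /(congr1 val) /=; rewrite !inordK ?is_ // => E; apply: val_inj => /=.
    by rewrite -(nth_index (val u) us) -(nth_index (val u) vs) E.
  move=> [] /(congr1 val) /=; rewrite !inordK ?it ?ut // => E; apply: val_inj => /=.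
  by rewrite -(nth_index (val u) (ut u us)) -(nth_index (val u) (ut v vs)) E.
exists f.
  by apply: inj_card_bij finj _; rewrite card_sum !card_ord card_sig -cU.
move=> u v; rewrite /f [RHS]/=/induced_edge; case: ifPn => us; case: ifPn => vs /=.
- by rewrite (ipath_edge ips us vs) /path_edge !inordK ?is_.
- by have [_ /negPf ->] := cr _ _ us (ut v vs).
- by rewrite edge_sym; have [_ /negPf ->] := cr _ _ vs (ut u us).
by rewrite (ipath_edge ipt (ut u us) (ut v vs)) /path_edge !inordK ?it ?ut.
Qed.

(** * Induced paths through a component between two vertices of [T] *)

Section Links.
Variables (G : sgraph) (S T : {set G}).
Hypothesis biST : biased S T.
Implicit Types (C K A Z : {set G}) (x y z u : G).
Let W := ~: (S :|: T).

(** The set [Z] records which vertices of [T] are known not to touch the path except for [a] and [b]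
    at its ends; [setT] means that this is known for all of [T]. *)
Definition tlink K Z a b : Prop := exists x q,
  [/\ ipath (x :: q), {subset x :: q <= K}, a \in T /\ b \in T,
      [/\ a != b, edge a x & edge b (last x q)] &
      forall u y, u \in x :: q -> y \in Z -> y \in T ->
        edge y u = (y == a) && (u == x) || (y == b) && (u == last x q) ].

Lemma tlinkC K Z a b : tlink K Z a b -> tlink K Z b a.
Proof.
move=> [x [q [ipq sub [aT bT] [ab ax bl] H]]].
have [y [r rE]] : exists y r, rev (x :: q) = y :: r.
  by rewrite lastI rev_rcons; exists (last x q), (rev (belast x q)).
have yE : y = last x q by have := congr1 (head x) rE; rewrite lastI rev_rcons.
have xE : last y r = x by rewrite -[last y r]/(last y (y :: r)) -rE rev_cons last_rcons.
have mE u : (u \in y :: r) = (u \in x :: q) by rewrite -rE mem_rev.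
exists y, r; split=> //.
- by rewrite -rE; apply: ipath_rev.
- by move=> u; rewrite mE; apply: sub.
- by rewrite eq_sym ab xE yE.
by move=> u z; rewrite mE xE yE orbC; apply: H.
Qed.

Lemma tlinkW K K' Z Z' a b : {subset K <= K'} -> Z' \subset Z -> tlink K Z a b -> tlink K' Z' a b.
Proof.
move=> KK ZZ [x [q [ipq sub abT abx H]]]; exists x, q; split=> //.
  by move=> u /sub/KK.
by move=> u y uq /(subsetP ZZ); apply: H.
Qed.

Lemma rest_nbr_uniq u y z : u \in W -> y \in T -> z \in T -> edge y u -> edge z u -> y = z.
Proof.
move=> uW yT zT yu zu; have /card_le1_eqP := barrier_rest_le1 biST uW.
by apply; rewrite !inE edge_sym ?yT ?zT andbT.
Qed.

(** A path in [K] between neighbours of [A] and of [A'] is trimmed until only its ends see them,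
    then made induced. Each end has a unique neighbour in [T]. Attachments outside [A :|: A'] remain
    uncontrolled. *)
Lemma tlink_across (K W' : {set G}) c (A A' : {set G}) :
  c \in W' -> W' \subset W -> K = comp W' c ->
  A \subset tnbr T K -> A' \subset tnbr T K -> A != set0 -> A' != set0 -> [disjoint A & A'] ->
  exists a a', [/\ a \in A, a' \in A' & tlink K (A :|: A') a a'].
Proof.
move=> cW' W'W KE AK A'K /set0Pn[a0 a0A] /set0Pn[a0' a0'A'] AA'.
have KW u : u \in K -> u \in W.
  by rewrite KE => /(subsetP (comp_sub cW'))/(subsetP W'W).
pose P u := [exists a in A, edge a u]; pose Q u := [exists a in A', edge a u].
have term (B : {set G}) b : B \subset tnbr T K -> b \in B ->
    b \in T /\ exists2 u, u \in K & edge b u.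
  by move=> BK /(subsetP BK); rewrite inE => /andP[bT /exists_inP[u uK bu]]; split=> //; exists u.
have [a0T [x0 x0K ax0]] := term _ _ AK a0A; have [a0'T [z0 z0K az0]] := term _ _ A'K a0'A'.
have : z0 \in comp W' x0.
  by rewrite comp_eq; move: x0K z0K; rewrite KE !comp_eq => /eqP <- /eqP <-.
rewrite inE => /connectP[p pth zE].
have Px0 : P x0 by apply/exists_inP; exists a0.
have Qz : Q (last x0 p) by rewrite -zE; apply/exists_inP; exists a0'.
have [x [q [pthq sub Px Ql [nP nQ]]]] := path_trim pth Px0 Qz.
have qK u : u \in x :: q -> u \in K.
  move/sub/(path_connect pth) => xu; rewrite KE comp_eq.
  by move: x0K; rewrite KE comp_eq => /eqP ->; rewrite -comp_eq inE.
have Pu u : u \in x :: q -> P u -> u = x.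
  by rewrite inE => /predU1P[//|uq Pu]; move/hasPn: nP => /(_ u uq); rewrite Pu.
have Qu u : u \in x :: q -> Q u -> u = last x q.
  rewrite lastI mem_rcons inE => /predU1P[//|uq Qu].
  by move/hasPn: nQ => /(_ u uq); rewrite Qu.
have [q' [pthq' unq' lq' subq']] : exists q',
    [/\ path (@edge G) x q', uniq (x :: q'), last x q' = last x q & {subset q' <= q}].
  case: (shortenP pthq) => q' pthq' unq' subq'; exists q'; split=> //.
  by apply: sub_path pthq' => u v /and3P[].
have [r [ipr lr subr']] := ipath_of_path pthq' unq'; rewrite lq' in lr.
have subr : {subset x :: r <= x :: q}.
  by move=> u /subr'; rewrite !inE => /predU1P[->|/subq' ->]; rewrite ?eqxx ?orbT.
have [a aA ax] := exists_inP Px; have [a' a'A' a'l] := exists_inP Ql.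
have [aT _] := term _ _ AK aA; have [a'T _] := term _ _ A'K a'A'.
exists a, a'; split=> //; exists x, r; split=> //.
- by move=> u /subr/qK.
- split=> //; last by rewrite lr.
  by apply: contraTneq a'A' => <-; rewrite (disjointFr AA' aA).
move=> u y ur yA yT; have uq := subr u ur; have uW := KW u (qK u uq).
apply/idP/orP => [yu|[/andP[/eqP -> /eqP ->] //|/andP[/eqP -> /eqP ->]]]; last by rewrite lr.
case/setUP: yA => [yA|yA'].
  left; have ux : u = x by apply: Pu => //; apply/exists_inP; exists y.
  by rewrite ux eqxx andbT; apply/eqP/(rest_nbr_uniq uW) => //; rewrite ux.
right; have ul : u = last x q by apply: Qu => //; apply/exists_inP; exists y.
by rewrite lr ul eqxx andbT; apply/eqP/(rest_nbr_uniq uW) => //; rewrite ul.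
Qed.

(** Apply [tlink_across] with [y] against all other attachments; the remaining vertices of [T] have
    no neighbour in [K], so the control extends to [setT]. *)
Lemma tlink_other (K W' : {set G}) c y : c \in W' -> W' \subset W -> K = comp W' c ->
  y \in tnbr T K -> tnbr T K :\ y != set0 ->
  exists x, [/\ x \in tnbr T K, x != y & tlink K setT y x].
Proof.
move=> cW' W'W KE yK K0.
have [||||a [x [/set1P -> xK lnk]]] := tlink_across cW' W'W KE (A := [set y]) _ _ _ K0.
- by rewrite sub1set.
- exact: subsetDl.
- by apply/set0Pn; exists y; rewrite set11.
- by rewrite disjoints1 !inE eqxx.
exists x; move: xK; rewrite in_setD1 => /andP[xy xK]; split=> //.
have [v [q [ipq sub [yT xT] yv H]]] := lnk; exists v, q; split=> //.
move=> u z uq _ zT; case: (boolP (z \in tnbr T K)) => zK.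
  by apply: H => //; rewrite in_setU1 in_setD1 zK andbT orbN.
have nz u' : u' \in v :: q -> edge z u' = false.
  move=> /sub u'K; apply: contraNF zK => zu; rewrite inE zT.
  by apply/exists_inP; exists u'.
rewrite nz //; have [_ yv' xl] := yv.
have zy : z != y by apply: contraNneq zK => ->.
have zx : z != x by apply: contraNneq zK => ->.
by rewrite (negPf zy) (negPf zx).
Qed.

Lemma big_comp_odd C : C \in big_comps S T -> C \in odd_comps S T.
Proof. by rewrite inE => /andP[]. Qed.

Lemma big_compE C : C \in big_comps S T -> exists2 c, c \in W & C = comp W c.
Proof. by move/big_comp_odd; rewrite inE => /andP[/imsetP[c cW ->] _]; exists c. Qed.

(** If [z] is attached to [C], delete its unique neighbour [w] there. The piece containing the
    neighbour of [y] has an even number of attachments, hence one besides [y], and [z] is not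
    attached to it. *)
Lemma tlink_two C y z : C \in big_comps S T -> y \in tnbr T C ->
  exists x, [/\ x \in tnbr T C, x != y, x != z & tlink C setT y x].
Proof.
move=> CB yC; have [c cW CE] := big_compE CB; have CO := big_comp_odd CB.
have C3 : 2 < #|tnbr T C| by move: CB; rewrite inE => /andP[].
have CW := odd_comp_sub CO.
have tnbrP t : t \in tnbr T C -> t \in T /\ exists2 u, u \in C & edge t u.
  by rewrite inE => /andP[tT /exists_inP[u uC tu]]; split=> //; exists u.
have [yT [v vC yv]] := tnbrP y yC.
case: (boolP ((z \in tnbr T C) && (z != y))) => [/andP[zC zy]|nz]; last first.
  have K0 : tnbr T C :\ y != set0.
    by rewrite -card_gt0; have := cardsD1 y (tnbr T C); rewrite yC; lia.
  have [x [xC xy lnk]] := tlink_other cW (subxx _) CE yC K0; exists x; split=> //.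
  by apply: contraNneq nz => <-; rewrite xC.
have [zT [w wC zw]] := tnbrP z zC; have wW := subsetP CW _ wC.
have vw : v != w.
  apply: contraNneq zy => vw; apply/eqP/(rest_nbr_uniq wW) => //; by rewrite -vw.
have CwE : comp W w = C := odd_comp_eq CO wC.
have vW : v \in W := subsetP CW _ vC.
have w0 : nbh w :&: T != set0 by apply/set0Pn; exists z; rewrite !inE edge_sym zw.
have vw' : v \in comp W w by rewrite CwE.
have := barrier_rest_even biST wW w0 vw' vw.
set K := comp _ v => evK.
have KC : K \subset C by rewrite -(odd_comp_eq CO vC); apply: comp_mono; apply: subsetDl.
have vWw : v \in W :\ w by rewrite in_setD1 vw.
have yK : y \in tnbr T K by rewrite inE yT; apply/exists_inP; exists v; rewrite ?mem_comp.
have K0 : tnbr T K :\ y != set0.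
  have KC' : K \subset comp W v by rewrite (odd_comp_eq CO vC).
  move: evK; rewrite (deg_toE biST vW KC') (cardsD1 y) yK /= negbK -card_gt0.
  by case: #|_|.
have [x [xK xy lnk]] := tlink_other vWw (subsetDl _ _) (erefl K) yK K0.
have xC : x \in tnbr T C.
  move: xK; rewrite !inE => /andP[-> /exists_inP[u /(subsetP KC) uC xu]].
  by apply/exists_inP; exists u.
exists x; split=> //; last by apply: tlinkW lnk => //; apply/subsetP.
move: xK; rewrite inE => /andP[xT /exists_inP[u uK xu]].
apply: contraTneq uK => xz; rewrite {}xz in xu.
have [inj _] := barrier_vertex biST zT.
apply/negP => uK; have uC := subsetP KC _ uK.
have nS u' : u' \in C -> u' \notin S.
  by move=> /(subsetP CW); rewrite !inE => /norP[].
have uw : u = w by apply: inj; rewrite ?inE ?nS // (odd_comp_eq CO uC).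
by have := subsetP (comp_sub vWw) _ uK; rewrite uw !inE eqxx.
Qed.
End Links.

(** * Connected hypergraphs of small excess *)

Ltac neq := by first [assumption | rewrite eq_sym; assumption].

Section Configuration.
Variables (V D : finType) (N : D -> {set V}) (F0 : {set D}).
Variable link : D -> {set V} -> V -> V -> Prop.
Implicit Types (F X B O : {set D}) (Z : {set V}) (u v w : D) (y z : V).

Hypothesis linkC : forall v Z y z, link v Z y z -> link v Z z y.
Hypothesis N_neq0 : forall v, v \in F0 -> N v != set0.
Hypothesis link_two : forall v y z, v \in F0 -> y \in N v ->
  exists x, [/\ x \in N v, x != y, x != z & link v setT y x].
Hypothesis link_across : forall v (A A' : {set V}), v \in F0 ->
  A \subset N v -> A' \subset N v -> A != set0 -> A' != set0 -> [disjoint A & A'] ->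
  exists y z, [/\ y \in A, z \in A' & link v (A :|: A') y z].

Definition fdeg F y := #|[set v in F | y \in N v]|.

Definition excess F := \sum_y (fdeg F y - 2).

Definition cut F X := [&& X \subset F, X != set0, X != F &
  [forall u in X, forall v in F :\: X, [disjoint N u & N v]]].

Definition fconnected F := [forall X, ~~ cut F X].

(* The linked sequences y1 v1 y2 v2 y3 v3 y4 and y5 v4 y6.  Only the passage through [v2]
   may touch vertices of [N v2] outside [Z], none of which is one of the [y]s. *)
Definition config : Prop := exists v1 v2 v3 v4 y1 y2 y3 y4 y5 y6 Z,
  [/\ all (mem F0) [:: v1; v2; v3; v4], uniq [:: v1; v2; v3; v4],
      uniq [:: y1; y2; y3; y4; y5; y6],
      all (mem Z) [seq y <- [:: y1; y2; y3; y4; y5; y6] | y \in N v2] &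
    [/\ link v1 setT y1 y2, link v2 Z y2 y3, link v3 setT y3 y4 & link v4 setT y5 y6] ].

Lemma cutP F X u v : cut F X -> u \in X -> v \in F -> v \notin X -> [disjoint N u & N v].
Proof.
move=> /and4P[_ _ _ /forall_inP cl] uX vF vX.
by have /forall_inP := cl u uX; apply; rewrite in_setD vX.
Qed.

Lemma cutC F X : cut F X -> cut F (F :\: X).
Proof.
move=> cX; have /and4P[XF X0 nXF _] := cX; apply/and4P; split.
- exact: subsetDl.
- by apply: contraNneq nXF => /eqP; rewrite setD_eq0 eqEsubset XF.
- apply: contraNneq X0 => E; apply/eqP/setP => u; rewrite inE; apply/negbTE/negP => uX.
  by have := subsetP XF u uX; rewrite -E in_setD uX.
apply/forall_inP => u /setDP[uF uX]; apply/forall_inP => v; rewrite !inE => /andP[+ vF].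
rewrite vF andbT negbK => vX; rewrite disjoint_sym; exact: cutP cX vX uF uX.
Qed.

Lemma fconnected_share F X : fconnected F -> X \subset F -> X != set0 -> X != F ->
  exists u v y, [/\ u \in X, v \in F, v \notin X, y \in N u & y \in N v].
Proof.
move=> /forallP/(_ X) + XF X0 nXF; rewrite /cut XF X0 nXF /= negb_forall => /existsP[u].
rewrite negb_imply => /andP[uX]; rewrite negb_forall => /existsP[v].
rewrite negb_imply in_setD -setI_eq0 => /andP[/andP[vX vF] /set0Pn[y /setIP[yu yv]]].
by exists u, v, y.
Qed.

Lemma fdeg_le2_notin F y u v w : fdeg F y <= 2 -> u \in F -> v \in F -> w \in F ->
  u != v -> u != w -> v != w -> y \in N u -> y \in N v -> y \notin N w.
Proof.
move=> deg2 uF vF wF uv uw vw yu yv; apply/negP => yw.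
have un : uniq [:: u; v; w] by rewrite /= !inE negb_or uv uw vw.
suff : 2 < fdeg F y by rewrite ltnNge deg2.
apply: (@leq_trans #|[:: u; v; w]|); first by rewrite (card_uniqP un).
apply: subset_leq_card; apply/subsetP => x; rewrite !inE.
by case/or3P => /eqP ->; apply/andP.
Qed.

(** [link_two] only keeps the far end off [z]; if the starting vertex happens to be [z], a second
    link from the far end repairs this. *)
Lemma link_avoid v z : v \in F0 ->
  exists x y, [/\ x \in N v, y \in N v, link v setT x y & [/\ x != y, x != z & y != z]].
Proof.
move=> vF; have /set0Pn[a av] := N_neq0 vF.
have [b [bv ba bz ab]] := link_two z vF av.
case: (eqVneq a z) => [az|az]; last by exists a, b; rewrite eq_sym ba.
have [c [cv cb cz bc]] := link_two z vF bv.
by exists b, c; rewrite eq_sym cb.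
Qed.

(** Here [v] is the middle crossing [v2], between [b] on the side [B] and [v'] on the side [O].
    Every chosen vertex lies in some hyperedge of [B] or [O], so those in [N v] automatically belong
    to the controlled set. *)
Lemma middle_config F v B O z y b v' v4 y1 y4 y5 y6 :
  F \subset F0 -> v \in F -> b \in B -> v' \in O -> v4 \in B :|: O ->
  B \subset F -> O \subset F -> v \notin B -> v \notin O -> [disjoint B & O] ->
  v4 != b -> v4 != v' -> z \in N b -> y \in N v' -> y1 \in N b -> y4 \in N v' ->
  y5 \in N v4 -> y6 \in N v4 ->
  link v ((N v :&: \bigcup_(u in B) N u) :|: (N v :&: \bigcup_(u in O) N u)) z y ->
  link b setT z y1 -> link v' setT y y4 -> link v4 setT y5 y6 ->
  uniq [:: y1; z; y; y4; y5; y6] -> config.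
Proof.
move=> FF vF bB v'O v4BO BF OF vB vO BO v4b v4v' zb yv' y1b y4v' y5v4 y6v4 lv lb lv' lv4 un.
have sub := subsetP FF; have subB := subsetP BF; have subO := subsetP OF.
exists b, v, v', v4, y1, z, y, y4, y5, y6.
exists ((N v :&: \bigcup_(u in B) N u) :|: (N v :&: \bigcup_(u in O) N u)).
have v4F : v4 \in F by case/setUP: v4BO => [/subB|/subO].
split; [ | | by [] | | by split; [exact: linkC| | |] ].
- by rewrite /= !sub //; [apply: subO|apply: subB].
- have bv : b != v by apply: contraNneq vB => <-.
  have bv' : b != v' by apply: contraTneq v'O => <-; rewrite (disjointFr BO bB).
  have vv' : v != v' by apply: contraNneq vO => ->.
  have vv4 : v != v4 by apply: contraTneq v4BO => <-; rewrite in_setU negb_or vB.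
  by rewrite /= !inE !negb_or bv bv' vv' vv4 (eq_sym b) v4b (eq_sym v') v4v'.
have inB u x : u \in B -> x \in N u -> x \in \bigcup_(u in B) N u.
  by move=> uB xu; apply/bigcupP; exists u.
have inO u x : u \in O -> x \in N u -> x \in \bigcup_(u in O) N u.
  by move=> uO xu; apply/bigcupP; exists u.
have in4 x : x \in N v4 -> (x \in \bigcup_(u in B) N u) || (x \in \bigcup_(u in O) N u).
  by move=> xv; case/setUP: v4BO => v4'; [rewrite (inB v4) | rewrite orbC (inO v4)].
rewrite all_filter; apply/allP => x; rewrite !inE => xs; apply/implyP => xv.
rewrite !xv /=; move: xs => /or4P[/eqP->|/eqP->|/eqP->|/or3P[/eqP->|/eqP->|/eqP->]].
- by rewrite (inB b).
- by rewrite (inB b).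
- by rewrite orbC (inO v').
- by rewrite orbC (inO v').
- by rewrite in4.
- by rewrite in4.
Qed.

(** With all degrees at most 2, a vertex shared by two hyperedges lies in no third, so the junctions
    [z] and [y] are safe and only the free ends can collide with the fourth hyperedge [v4]. *)
Lemma base_config_at F m b w z y : F \subset F0 -> 3 < #|F| ->
  (forall y, fdeg F y <= 2) -> uniq [:: m; b; w] -> all (mem F) [:: m; b; w] ->
  z \in N m -> z \in N b -> y \in N m -> y \in N w -> config.
Proof.
move=> FF F4 deg2 un /and4P[/= mF bF wF _] zm zb ym yw.
have sub := subsetP FF.
have two y' u1 u2 u3 : u1 \in F -> u2 \in F -> u3 \in F -> u1 != u2 -> u1 != u3 -> u2 != u3 ->
    y' \in N u1 -> y' \in N u2 -> y' \notin N u3 by exact: fdeg_le2_notin.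
move: un; rewrite /= !inE negb_or andbT => /andP[/andP[mb mw] bw].
pose O := F :\ m :\ b; pose B := [set b].
have BE : \bigcup_(u in B) N u = N b by rewrite big_set1.
have wO : w \in O by rewrite !inE eq_sym bw eq_sym mw.
have [z' [y' [zA yA lv]]] : exists z y, [/\ z \in N m :&: \bigcup_(u in B) N u,
    y \in N m :&: \bigcup_(u in O) N u &
    link m ((N m :&: \bigcup_(u in B) N u) :|: (N m :&: \bigcup_(u in O) N u)) z y].
  apply: link_across; rewrite ?subsetIl ?sub //.
  - by apply/set0Pn; exists z; rewrite inE zm BE.
  - by apply/set0Pn; exists y; rewrite inE ym; apply/bigcupP; exists w.
  rewrite -setI_eq0; apply/eqP/setP => x; rewrite !inE BE; apply/negP.
  move=> /andP[/andP[xm xb] /andP[_ /bigcupP[u + xu]]]; rewrite !inE => /and3P[ub um uF].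
  suff : x \notin N u by rewrite xu.
  by apply: (two _ m b) => //; neq.
move: zA yA {z y zm zb ym yw} lv; rewrite BE; move: z' y' => z y /setIP[zm zb] /setIP[ym].
case/bigcupP => v' v'O yv' lv; move: (v'O); rewrite !inE => /and3P[v'b v'm v'F].
have [v4 v4O v4v'] : exists2 v4, v4 \in O & v4 != v'.
  have : 0 < #|O :\ v'|.
    have bFm : b \in F :\ m by rewrite in_setD1 bF andbT; neq.
    have := cardsD1 m F; have := cardsD1 b (F :\ m); have := cardsD1 v' O.
    by rewrite mF bFm v'O -/O; move: F4; clear; lia.
  by case/card_gt0P => v4; rewrite in_setD1 => /andP[]; exists v4.
move: (v4O); rewrite !inE => /and3P[v4b v4m v4F].
have bv' : b != v' by rewrite eq_sym.
have fin y1 y4 y5 y6 : y1 \in N b -> y4 \in N v' -> y5 \in N v4 -> y6 \in N v4 ->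
    link b setT z y1 -> link v' setT y y4 -> link v4 setT y5 y6 ->
    y1 != z -> y4 != y -> y5 != y6 -> y1 != y4 -> y1 != y5 -> y1 != y6 ->
    y4 != y5 -> y4 != y6 -> config.
  move=> y1b y4v' y5v4 y6v4 l1 l4 l56 y1z y4y y56 y14 y15 y16 y45 y46.
  apply: (@middle_config F m B O z y b v' v4 y1 y4 y5 y6) => //; rewrite ?set11 ?sub1set //.
  - by rewrite inE v4O orbT.
  - by apply/subsetP => u; rewrite !inE => /and3P[].
  - by rewrite inE.
  - by rewrite !inE eqxx andbF.
  - by rewrite disjoints1 !inE eqxx.
  - by rewrite BE.
  have zv' : z \notin N v' by apply: (two _ m b) => //; neq.
  have zv4 : z \notin N v4.
    by apply: (two _ m b) => //; neq.
  have yb : y \notin N b.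
    by apply: (two _ m v') => //; neq.
  have yv4 : y \notin N v4.
    by apply: (two _ m v') => //; neq.
  have zy : z != y by apply: contraNneq zv' => ->.
  have zy4 : z != y4 by apply: contraNneq zv' => ->.
  have zy5 : z != y5 by apply: contraNneq zv4 => ->.
  have zy6 : z != y6 by apply: contraNneq zv4 => ->.
  have y1y : y1 != y by apply: contraNneq yb => <-.
  have yy5 : y != y5 by apply: contraNneq yv4 => ->.
  have yy6 : y != y6 by apply: contraNneq yv4 => ->.
  rewrite /= !inE !negb_or y1z y1y y14 y15 y16 zy zy4 zy5 zy6 (eq_sym y y4) y4y.
  by rewrite yy5 yy6 y45 y46 y56.
have [a [ab az _ la]] := link_two z (sub _ bF) zb.
have [a' [a'b a'z a'a la']] := link_two a (sub _ bF) zb.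
have [c [cv cy _ lc]] := link_two y (sub _ v'F) yv'.
have [c' [c'v c'y c'c lc']] := link_two c (sub _ v'F) yv'.
have outb x : x \in N b -> x != z -> link b setT z x -> x \notin N v4 -> config.
  move=> xb xz lx xv4; have [y4 [y4v y4y y4x l4]] := link_two x (sub _ v'F) yv'.
  have [y5 [y6 [y5v y6v l56 [y56 y54 y64]]]] := link_avoid y4 (sub _ v4F).
  apply: (fin x y4 y5 y6) => //; rewrite 1?eq_sym //.
    by apply: contraNneq xv4 => <-.
  by apply: contraNneq xv4 => <-.
have outv x : x \in N v' -> x != y -> link v' setT y x -> x \notin N v4 -> config.
  move=> xv xy lx xv4; have [y1 [y1b y1z y1x l1]] := link_two x (sub _ bF) zb.
  have [y5 [y6 [y5v y6v l56 [y56 y51 y61]]]] := link_avoid y1 (sub _ v4F).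
  apply: (fin y1 x y5 y6) => //; rewrite 1?eq_sym //.
    by apply: contraNneq xv4 => <-.
  by apply: contraNneq xv4 => <-.
case: (boolP (a \in N v4)) => [av4|]; last exact: outb.
case: (boolP (a' \in N v4)) => [a'v4|]; last exact: outb.
case: (boolP (c \in N v4)) => [cv4|]; last exact: outv.
case: (boolP (c' \in N v4)) => [c'v4|]; last exact: outv.
(* All four candidate ends lie in [N v4]. By the degree bound those of [b] differ from those of
   [v'], so [v4] can start at the spare end [c'], and the spare ends leave room to avoid where it
   stops. *)
have bneq x : x \in N b -> x \in N v4 -> x \notin N v'.
  by move=> xb xv; apply: (two _ b v4) => //; neq.
have ac : a != c by apply: contraNneq (bneq a ab av4) => ->.
have ac' : a != c' by apply: contraNneq (bneq a ab av4) => ->.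
have a'c : a' != c by apply: contraNneq (bneq a' a'b a'v4) => ->.
have a'c' : a' != c' by apply: contraNneq (bneq a' a'b a'v4) => ->.
have [x [xv xc' xc lx]] := link_two c (sub _ v4F) c'v4.
case: (eqVneq x a) => xa.
  rewrite xa in lx.
  by apply: (fin a' c c' a) => //; rewrite 1?eq_sym // ac'.
by apply: (fin a c c' x) => //; rewrite 1?eq_sym // 1?eq_sym.
Qed.

Lemma base_config F : F \subset F0 -> fconnected F -> 3 < #|F| ->
  (forall y, fdeg F y <= 2) -> config.
Proof.
move=> FF conF F4 deg2.
have /card_gt0P[a aF] : 0 < #|F| by apply: leq_trans F4.
have [|||u [v [y [/set1P -> vF]]]] := fconnected_share conF (X := [set a]).
- by rewrite sub1set.
- by apply/set0Pn; exists a; rewrite set11.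
- by apply: contraTneq F4 => <-; rewrite cards1.
rewrite in_set1 => va ya yv.
have [|||u' [w [z [u'X wF]]]] := fconnected_share conF (X := [set a; v]).
- by rewrite subUset !sub1set aF.
- by apply/set0Pn; exists a; rewrite !inE eqxx.
- by apply: contraTneq F4 => <-; rewrite cards2 eq_sym va.
rewrite !inE negb_or => /andP[wa wv] zu zw.
case/set2P: u'X zu => -> zu.
  apply: (@base_config_at F a v w y z) => //=; rewrite ?aF ?vF ?wF // !inE negb_or.
  by rewrite eq_sym va eq_sym wa eq_sym wv.
apply: (@base_config_at F v a w y z) => //=; rewrite ?aF ?vF ?wF // !inE negb_or.
by rewrite va eq_sym wv eq_sym wa.
Qed.

(** Removing [v] leaves the sides [B] and [O], which share no vertex, so collisions are possible
    only within one side. The fourth hyperedge is taken from [B] if [B] has two members, and from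
    [O] otherwise. *)
Lemma branch_config F v B ys : F \subset F0 -> fconnected F -> 4 + excess F <= #|F| ->
  v \in F -> ys \in N v -> 2 < fdeg F ys -> cut (F :\ v) B ->
  (forall b y, b \in B -> y \in N b -> fdeg F y <= 2) -> config.
Proof.
move=> FF conF F4 vF ysv ysF cB Bdeg; have sub := subsetP FF.
pose O := F :\ v :\: B.
have /and4P[BFv B0 _ _] := cB; have /and4P[OFv O0 _ _] := cutC cB.
have BF : B \subset F by apply: subset_trans BFv (subsetDl _ _).
have OF : O \subset F by apply: subset_trans OFv (subsetDl _ _).
have subB := subsetP BF; have subO := subsetP OF.
have vB : v \notin B by apply/negP => /(subsetP BFv); rewrite !inE eqxx.
have vO : v \notin O by apply/negP => /(subsetP OFv); rewrite !inE eqxx.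
have BO : [disjoint B & O] by rewrite -setI_eq0; apply/eqP/setP => u; rewrite !inE; case: (u \in B).
have FE u : u \in F -> [\/ u = v, u \in B | u \in O].
  rewrite in_setD in_setD1; case: (eqVneq u v) => [->|uv] uF; first by constructor 1.
  by case: (boolP (u \in B)) => uB; [constructor 2 | constructor 3; rewrite uF].
have disj b o y : b \in B -> o \in O -> y \in N b -> y \in N o -> False.
  move=> bB oO yb yo; move: oO; rewrite in_setD => /andP[oB oF].
  by have := cutP cB bB oF oB => /disjointFr/(_ yb); rewrite yo.
pose A := N v :&: \bigcup_(u in B) N u; pose A' := N v :&: \bigcup_(u in O) N u.
have [z0 z0A] : exists z, z \in A.
  have nBF : B != F by apply: contraNneq vB => ->.
  have [b [q [y [bB qF qB yb yq]]]] := fconnected_share conF BF B0 nBF.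
  exists y; rewrite inE; apply/andP; split; last by apply/bigcupP; exists b.
  by case: (FE q qF) => [<-|qB'|qO] //; [rewrite qB' in qB | case: (disj b q y)].
have [y0 y0A] : exists y, y \in A'.
  have nOF : O != F by apply: contraNneq vO => ->.
  have [o [q [y [oO qF qO yo yq]]]] := fconnected_share conF OF O0 nOF.
  exists y; rewrite inE; apply/andP; split; last by apply/bigcupP; exists o.
  by case: (FE q qF) => [<-|qB|qO'] //; [case: (disj q o y) | rewrite qO' in qO].
have [z [y [zA yA lv]]] : exists z y, [/\ z \in A, y \in A' & link v (A :|: A') z y].
  apply: link_across; rewrite ?subsetIl ?sub //.
  - by apply/set0Pn; exists z0.
  - by apply/set0Pn; exists y0.
  rewrite -setI_eq0; apply/eqP/setP => x; rewrite !inE; apply/negP.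
  move=> /andP[/andP[_ /bigcupP[b bB xb]] /andP[_ /bigcupP[o oO xo]]]; exact: (disj b o x).
move: zA yA; rewrite !inE => /andP[zv /bigcupP[b bB zb]] /andP[yv /bigcupP[v' v'O yv']].
have [y1 [y1b y1z _ l1]] := link_two z (sub _ (subB _ bB)) zb.
have neB x x' b' o' : b' \in B -> o' \in O -> x \in N b' -> x' \in N o' -> x != x'.
  by move=> b'B o'O xb; apply: contraTneq => <-; apply/negP => xo; apply: (disj b' o' x).
have mid := @middle_config F v B O z y b v'.
case: (leqP #|B| 1) => B2; last first.
  have [v4 v4B v4b] : exists2 v4, v4 \in B & v4 != b.
    have : 0 < #|B :\ b| by move: B2; rewrite (cardsD1 b B) bB.
    by case/card_gt0P => v4; rewrite in_setD1 => /andP[]; exists v4.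
  have [y4 [y4v' y4y _ l4]] := link_two y (sub _ (subO _ v'O)) yv'.
  have [y5 [y6 [y5v y6v l56 [y56 y51 y61]]]] := link_avoid y1 (sub _ (subB _ v4B)).
  have zv4 : z \notin N v4.
    apply: (@fdeg_le2_notin F z v b v4) => //; [exact: (Bdeg b) | exact: subB | exact: subB | | |].
    - by apply: contraNneq vB => ->.
    - by apply: contraNneq vB => ->.
    by rewrite eq_sym.
  have v4v' : v4 != v' by apply: contraTneq v'O => <-; rewrite (disjointFr BO v4B).
  apply: (mid v4 y1 y4 y5 y6) => //; first by rewrite in_setU v4B.
  rewrite /= !inE !negb_or y1z (neB y1 y b v') // (neB y1 y4 b v') //.
  rewrite (neB z y b v') // (neB z y4 b v') //.
  rewrite !(eq_sym y1) y51 y61 !(eq_sym y) y4y (neB y5 y v4 v') // (neB y6 y v4 v') //.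
  rewrite !(eq_sym y4) (neB y5 y4 v4 v') // (neB y6 y4 v4 v') // y56 !andbT /=.
  by apply/andP; split; apply: contraNneq zv4 => ->.
(* Three hyperedges pass through [ys], and none of them is in [B], whose vertices have degree at
   most 2. *)
have O2 : 1 < #|O|.
  have : fdeg F ys <= #|v |: O|.
    apply: subset_leq_card; apply/subsetP => u; rewrite inE => /andP[uF uys].
    rewrite in_setU1; case: (FE u uF) => [->|uB|->]; rewrite ?eqxx ?orbT //.
    by move: ysF; rewrite ltnNge (Bdeg u ys).
  by rewrite cardsU1 vO; move: ysF; clear; lia.
have fin v4 y4 y5 y6 : v4 \in O -> v4 != v' -> y4 \in N v' -> y4 != y -> link v' setT y y4 ->
    y5 \in N v4 -> y6 \in N v4 -> link v4 setT y5 y6 -> y5 != y6 ->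
    y5 != y -> y6 != y -> y5 != y4 -> y6 != y4 -> config.
  move=> v4O v4v' y4v' y4y l4 y5v y6v l56 y56 y5y y6y y54 y64.
  have v4b : v4 != b by apply: contraTneq v4O => ->; rewrite (disjointFr BO bB).
  apply: (mid v4 y1 y4 y5 y6) => //; first by rewrite in_setU v4O orbT.
  rewrite /= !inE !negb_or y1z (neB y1 y b v') // (neB y1 y4 b v') // (neB y1 y5 b v4) //.
  rewrite (neB y1 y6 b v4) // (neB z y b v') // (neB z y4 b v') // (neB z y5 b v4) //.
  by rewrite (neB z y6 b v4) // !(eq_sym y) y4y y5y y6y !(eq_sym y4) y54 y64 y56.
have v'F : v' \in F0 by apply/sub/subO.
have [c [cv cy _ lc]] := link_two y v'F yv'.
have [c' [c'v c'y c'c lc']] := link_two c v'F yv'.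
case: (boolP [exists v4 in O :\ v', ~~ [&& y \in N v4, c \in N v4 & c' \in N v4]]).
  case/exists_inP => v4; rewrite in_setD1 => /andP[v4v' v4O] miss.
  have v4F : v4 \in F0 by apply/sub/subO.
  have [yv4|yv4] := boolP (y \in N v4); last first.
    have [y5 [y6 [y5v y6v l56 [y56 y5c y6c]]]] := link_avoid c v4F.
    by apply: (fin v4 c y5 y6) => //; apply: contraNneq yv4 => <-.
  have [y5 [y6 [y5v y6v l56 [y56 y5y y6y]]]] := link_avoid y v4F.
  have [cv4|cv4] := boolP (c \in N v4); last first.
    by apply: (fin v4 c y5 y6) => //; apply: contraNneq cv4 => <-.
  have c'v4 : c' \notin N v4 by move: miss; rewrite yv4 cv4.
  by apply: (fin v4 c' y5 y6) => //; apply: contraNneq c'v4 => <-.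
rewrite negb_exists_in => /forall_inP all3.
have all3' u : u \in O -> [&& y \in N u, c \in N u & c' \in N u].
  move=> uO; case: (eqVneq u v') => [->|uv']; first by rewrite yv' cv.
  by rewrite -[X in is_true X]negbK; apply: all3; rewrite in_setD1 uv'.
(* If no fourth hyperedge works, [y], [c] and [c'] lie in all of [O], and the excess is at least
   [(|O| - 1) + 2(|O| - 2)]. With [|F| <= |O| + 2] and [|O| >= 2] this contradicts
   [4 + excess F <= #|F|]. *)
have dy : #|O|.+1 <= fdeg F y.
  have -> : #|O|.+1 = #|v |: O| by rewrite cardsU1 vO.
  apply: subset_leq_card; apply/subsetP => u; rewrite in_setU1 inE.
  by case/predU1P => [->|uO]; rewrite ?vF ?yv // subO //; case/and3P: (all3' u uO).
have dc : #|O| <= fdeg F c.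
  apply: subset_leq_card; apply/subsetP => u uO; rewrite inE subO //.
  by case/and3P: (all3' u uO).
have dc' : #|O| <= fdeg F c'.
  apply: subset_leq_card; apply/subsetP => u uO; rewrite inE subO //.
  by case/and3P: (all3' u uO).
have : #|F| <= #|O| + 2.
  have := cardsD1 v F; have := cardsID B (F :\ v); rewrite vF -/O.
  have : #|(F :\ v) :&: B| <= #|B| by apply: subset_leq_card; apply: subsetIr.
  by move: B2; clear; lia.
have : (fdeg F y - 2) + ((fdeg F c - 2) + (fdeg F c' - 2)) <= excess F.
  rewrite /excess (bigD1 y) //= leq_add2l (bigD1 c) //= leq_add2l (bigD1 c') ?leq_addr //.
  by rewrite c'y c'c.
by move: O2 F4 dy dc dc'; clear; lia.
Qed.

Lemma fdegD1 F v y : v \in F -> fdeg F y = (y \in N v) + fdeg (F :\ v) y.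
Proof.
move=> vF; rewrite /fdeg (cardsD1 v) inE vF /=; congr (_ + _); apply: eq_card => u.
by rewrite !inE andbA.
Qed.

(** Removing a hyperedge through a vertex of degree above 2 lowers the excess, so the bound survives
    if [F] stays connected. Otherwise every such hyperedge is a cut, and a smallest side [B] among
    all these cuts contains none of them. *)
Theorem connected_config F : F \subset F0 -> fconnected F -> 4 + excess F <= #|F| -> config.
Proof.
move Fn : #|F| => n; elim: n F Fn => [|n IH] F Fn FF conF F4; first by [].
case: (boolP [exists y, 2 < fdeg F y]) => [/existsP[y0 y0F]|]; last first.
  rewrite negb_exists => /forallP deg2; apply: (base_config FF conF).
    by rewrite Fn; move: F4; clear; lia.
  by move=> y; rewrite leqNgt.
pose high v := (v \in F) && [exists y in N v, 2 < fdeg F y].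
case: (boolP [exists v, high v && fconnected (F :\ v)]) => [/existsP[v]|].
  case/andP => /andP[vF /exists_inP[y yv yF]] conFv.
  have cF : #|F :\ v| = n by move: Fn; rewrite (cardsD1 v) vF => -[].
  apply: (IH _ cF _ conFv); first exact: subset_trans (subsetDl _ _) FF.
  suff : excess (F :\ v) < excess F by move: F4; clear; lia.
  rewrite /excess (bigD1 y) //= [X in _ < X](bigD1 y) //= -addSn leq_add //.
    by move: yF; rewrite (fdegD1 y vF) yv; clear; lia.
  by apply: leq_sum => x _; rewrite (fdegD1 x vF); clear; lia.
rewrite negb_exists => /forallP ncon.
have hcut v : high v -> exists X, cut (F :\ v) X.
  move=> hv; have := ncon v; rewrite hv negb_forall => /existsP[X]; rewrite negbK => cX.
  by exists X.
have [v0 v0h] : exists v, high v.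
  have /card_gt0P[v] : 0 < fdeg F y0 by apply: leq_trans y0F.
  rewrite inE => /andP[vF y0v]; exists v; rewrite /high vF; apply/exists_inP.
  by exists y0.
have [X0 cX0] := hcut v0 v0h.
pose P (p : D * {set D}) := high p.1 && cut (F :\ p.1) p.2.
have P0 : P (v0, X0) by rewrite /P v0h.
case: (@arg_minnP _ (v0, X0) P (fun p => #|p.2|) P0) => -[v B] /andP[/= vh cB] Bmin.
have /andP[vF /exists_inP[ys ysv ysF]] := vh.
apply: (@branch_config F v B ys) => //; first by rewrite Fn.
move=> u y uB yu; rewrite leqNgt; apply/negP => yF.
have [BFv _ _ _] := and4P cB; have [OFv _ _ _] := and4P (cutC cB).
have uFv : u \in F :\ v := subsetP BFv u uB.
move: (uFv); rewrite in_setD1 => /andP[uv uF].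
have uh : high u by rewrite /high uF; apply/exists_inP; exists y.
(* A hyperedge [u] of [B] with a vertex of high degree would itself be a cut. Its side [X] avoiding
   [v] cannot meet [O], since [X :&: O] would be cut off from all of [F]; so [X] lies in [B] without
   [u], against minimality. *)
have [X cX vX] : exists2 X, cut (F :\ u) X & v \notin X.
  have [X cX] := hcut u uh; case: (boolP (v \in X)) => vX; last by exists X.
  by exists (F :\ u :\: X); [exact: cutC | rewrite in_setD vX].
have [XFu X0n _ _] := and4P cX.
pose O := F :\ v :\: B.
have XO : X :&: O = set0.
  apply/eqP/negPn/negP => Y0; move/forallP: conF => /(_ (X :&: O)) /negP; apply.
  apply/and4P; split=> //.
  - by apply/subsetP => w /setIP[/(subsetP XFu)]; rewrite in_setD1 => /andP[].
  - by apply: contraNneq vX => E; move: vF; rewrite -E => /setIP[].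
  apply/forall_inP => p /setIP[pX pO]; apply/forall_inP => q.
  rewrite in_setD in_setI negb_and => /andP[qn qF].
  have pO' := pO; move: pO'; rewrite in_setD => /andP[pB pFv].
  have BO w : w \in B -> [disjoint N p & N w].
    by move=> wB; rewrite disjoint_sym; apply: (cutP cB wB pFv pB).
  case: (boolP (q \in X)) qn => [qX /= qO|qX _].
    apply: BO; move: qO; rewrite in_setD in_setD1 qF andbT negb_and !negbK.
    by case/orP => // /eqP qv; rewrite -qv qX in vX.
  case: (eqVneq q u) => [->|qu]; first exact: BO.
  by apply: (cutP cX pX) => //; rewrite in_setD1 qu.
have : #|B| <= #|X| by apply: (Bmin (u, X)); rewrite /P /= uh.
rewrite leqNgt => /negP; apply; apply: proper_card; apply/properP; split.
  apply/subsetP => w wX; have := subsetP XFu w wX; rewrite in_setD1 => /andP[_ wF].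
  apply/negPn/negP => wB; have := in_set0 w; rewrite -XO inE wX in_setD wB in_setD1 wF andbT.
  by move=> /negbFE/eqP wv; rewrite -wv wX in vX.
by exists u => //; apply/negP => /(subsetP XFu); rewrite !inE eqxx.
Qed.
End Configuration.

(** * Toughness *)

Lemma tough_three_halves (G : sgraph) (U : {set G}) : tough (3%:R / 2%:R)%R G ->
  1 < components (del_vertices U) -> 3 * components (del_vertices U) <= 2 * #|U|.
Proof.
move=> tG c2; have : ((3%:R / 2%:R)%:E <=
    ((#|U|%:R / (components (del_vertices U))%:R)%R : rat)%:E)%E.
  by apply: Order.POrderTheory.le_trans tG _; apply: Order.TotalTheory.bigmin_le_cond.
rewrite lee_fin Num.Theory.ler_pdivrMr ?Num.Theory.ltr0n //.
rewrite GRing.mulrAC Num.Theory.ler_pdivlMr ?Num.Theory.ltr0n //; last by lia.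
by rewrite -!GRing.natrM Num.Theory.ler_nat [#|U| * 2]mulnC.
Qed.

(** A label constant along edges is constant on components, so toughness can be applied through
    labels without describing the components. *)
Lemma card_labels_components (G : sgraph) (U : {set G}) (L : finType) (f : G -> L) :
  (forall x y, x \notin U -> y \notin U -> edge x y -> f x = f y) ->
  #|f @: ~: U| <= components (del_vertices U).
Proof.
move=> fE; pose H := del_vertices U; pose e : rel H := @edge H.
have eC : connect_sym e by apply: sym_connect_sym; apply: edge_sym.
have vU (x : H) : val x \notin U by have := valP x; rewrite inE.
have fc (x y : H) : connect e x y -> f (val x) = f (val y).
  move=> /connectP[p pth ->]; elim: p x pth => //= y' p IH x /andP[xy /IH <-].
  by apply: fE => //; apply: vU.
rewrite /components /n_comp_mem.
apply: (@leq_trans #|[set f (val x) | x in [set x : H | fingraph.roots e x]]|).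
  apply: subset_leq_card; apply/subsetP => _ /imsetP[x xU ->].
  pose x' : H := exist _ x xU.
  apply/imsetP; exists (fingraph.root e x'); last by rewrite -(fc x') ?connect_root.
  by rewrite inE roots_root.
apply: leq_trans (leq_imset_card _ _) _; rewrite cardsE.
by apply: subset_leq_card; apply/subsetP => x; rewrite !inE andbT.
Qed.

Section ToughBarrier.
Variables (G : sgraph) (S T : {set G}).
Hypothesis G3 : 2 < #|G|.
Hypothesis tG : tough (3%:R / 2%:R)%R G.
Hypothesis biST : biased S T.
Let W := ~: (S :|: T).
Let B := big_comps S T.
Implicit Types (C : {set G}) (x y z r : G).

Lemma labels_tough (U : {set G}) (L : finType) (f : G -> L) (n : nat) :
  (forall x y, x \notin U -> y \notin U -> edge x y -> f x = f y) ->
  n <= #|f @: ~: U| -> 1 < n -> 3 * n <= 2 * #|U|.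
Proof.
move=> fE nf n1; have nc := leq_trans nf (card_labels_components fE).
by apply: leq_trans (tough_three_halves tG (leq_trans n1 nc)); rewrite leq_mul2l.
Qed.

(** For [S] empty and all degrees in [T] at least 3, the barrier gives more than [|T|] odd
    components of [G - T], contradicting toughness. A vertex of [T] of smaller degree forces [G] to
    be tiny. This is where the bound of three vertices enters. *)
Lemma biased_tough_S_neq0 : S != set0.
Proof.
apply/negP => /eqP S0.
have WE : ~: T = W by rewrite /W S0 set0U.
have cO : 1 < #|odd_comps S T| -> 3 * #|odd_comps S T| <= 2 * #|T|.
  apply: (@labels_tough _ _ (comp W)) => [x y xT yT|]; last first.
    by rewrite WE; apply: subset_leq_card; apply/subsetP => C; rewrite inE => /andP[].
  by apply: comp_edge; rewrite -WE in_setC.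
have [/andP[_ bar] _ _] := biST.
have sumE : \sum_(y in T) #|nbh y :\: S| = \sum_(y in T) #|nbh y|.
  by apply: eq_bigr => y _; rewrite S0 setD0.
have cS0 : #|S| = 0 by rewrite S0 cards0.
rewrite sumE cS0 muln0 add0n in bar.
case: (boolP [forall y in T, 2 < #|nbh y|]) => [/forall_inP deg3|].
  have : 3 * #|T| <= \sum_(y in T) #|nbh y|.
    by rewrite mulnC -sum_nat_const; apply: leq_sum.
  move: bar cO; move: (\sum_(y in T) #|nbh y|) => sm; move: #|odd_comps S T| #|T| => o t.
  clear=> bar cO sm3; have : 3 * o <= 2 * t by apply: cO; move: bar sm3; lia.
  by move: bar sm3; lia.
rewrite negb_forall_in => /exists_inP[y yT]; rewrite -leqNgt => deg2.
(* Deleting the at most two neighbours of [y] would separate it from a non-neighbour, against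
   toughness. *)
have adj z : z != y -> edge y z.
  move=> zy; apply/negPn/negP => nyz.
  suff : 3 * 2 <= 2 * #|nbh y| by move: deg2; clear; lia.
  apply: (@labels_tough _ _ (fun x => x == y)) => // [u v|].
    rewrite !inE; case: (eqVneq u y) => [->|_]; case: (eqVneq v y) => [->|_] //.
      by move=> _ /negPf ->.
    by rewrite edge_sym => /negPf ->.
  rewrite -card_bool -cardsT; apply: subset_leq_card; apply/subsetP => -[] _.
    by apply/imsetP; exists y; rewrite ?eqxx // !inE edge_irrefl.
  by apply/imsetP; exists z; rewrite ?(negPf zy) // !inE nyz.
have nE : nbh y = ~: [set y].
  apply/setP => z; rewrite !inE; case: (eqVneq z y) => [->|/adj->] //.
  by rewrite edge_irrefl.
have TE : T = [set y].
  apply/eqP; rewrite eqEsubset sub1set yT andbT; apply/subsetP => z zT.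
  rewrite inE; apply/negPn/negP => /adj; exact/negP/(barrier_indep biST).
have nc : #|nbh y| = 2.
  apply/eqP; rewrite eqn_leq deg2 /=; have := cardsC [set y]; rewrite -nE cards1.
  by move: G3; clear; lia.
have cT : #|T| = 1 by rewrite TE cards1.
move: bar cO; rewrite {1}TE big_set1 cT nc; move: #|odd_comps _ _| => o.
by clear => bar cO; have := cO; rewrite (_ : 1 < o); [move/(_ isT) | ]; move: bar; clear; lia.
Qed.

(** * Classes of [T] under common hyperedges, and the deleted set *)

Definition hrel y z := [exists C in B, (y \in tnbr T C) && (z \in tnbr T C)].

Lemma hrel_csym : connect_sym hrel.
Proof.
by apply: sym_connect_sym => y z; apply: eq_existsb => C; rewrite [_ && (z \in _)]andbC.
Qed.

Let rt := fingraph.root hrel.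
Let d y := fdeg (tnbr T) B y.
Let leaf y := d y == 1.
(* One vertex of each class keeps its edges, so that the rest of the class still counts as
   a component; choosing it of degree other than 1 avoids wasting a leaf. *)
Definition rep r := if [pick y in T | (rt y == r) && ~~ leaf y] is Some y then y else r.
Definition cutl y := [&& y \in T, leaf y & y != rep (rt y)].

Lemma rt_hrel y z : hrel y z -> rt y = rt z.
Proof. by move=> yz; apply/eqP; rewrite fingraph.root_connect ?connect1 //; apply: hrel_csym. Qed.

Lemma rt_T y : y \in T -> rt y \in T.
Proof.
move=> yT; rewrite /rt; have /connectP[p pth ->] := connect_root hrel y.
elim: p y yT pth => //= z p IH y yT /andP[/existsP[C /and3P[_ _ zC]]]; apply: IH.
by move: zC; rewrite inE => /andP[].
Qed.

Lemma rt_idem y : rt (rt y) = rt y.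
Proof. exact: root_root hrel_csym _. Qed.

Lemma repP y : y \in T -> [/\ rep (rt y) \in T, rt (rep (rt y)) = rt y &
  (exists z, [/\ z \in T, rt z = rt y & ~~ leaf z]) -> ~~ leaf (rep (rt y))].
Proof.
move=> yT; rewrite /rep; case: pickP => [z /and3P[zT /eqP zr nz]|no]; first by split.
split; [exact: rt_T | exact: rt_idem |].
by case=> z [zT zr nz]; have := no z; rewrite zT zr eqxx nz.
Qed.

Let cuts := [set y | cutl y].
Let cls := rt @: T.
Let term := [set x in W | (comp W x \in B) && [exists y in cuts, edge y x]].

(** A cut leaf lies in a single big component and has a single neighbour there, so each deleted
    attachment can be charged to a leaf of its own. *)
Lemma card_term : #|term| <= #|cuts|.
Proof.
pose g x := [pick y in cuts | edge y x].
have Sinj : injective (@Some G) by move=> i j [].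
have ginj : {in term &, injective g}.
  move=> x x'; rewrite [x \in _]inE [x' \in _]inE.
  move=> /and3P[xW xB /exists_inP[y0 y0c y0x]] /and3P[x'W x'B _].
  rewrite /g; case: pickP => [y /andP[yc yx]|/(_ y0)]; last by rewrite y0c y0x.
  case: pickP => [y' /andP[_ y'x']|//] [yy']; rewrite -{}yy' {y'} in y'x'.
  move: yc; rewrite inE => /and3P[yT /eqP leafy _].
  have [_ yC] := mem_tnbr biST yT xW yx; have [_ yC'] := mem_tnbr biST yT x'W y'x'.
  have /cards1P[C CE] := introT eqP leafy.
  have E z : comp W z \in B -> y \in tnbr T (comp W z) -> comp W z = C.
    by move=> zB yz; apply/set1P; rewrite -CE inE zB.
  have [inj _] := barrier_vertex biST yT.
  have nS z : z \in W -> z \notin S by rewrite !inE => /norP[].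
  by apply: inj; [rewrite !inE nS // | rewrite !inE nS // | rewrite (E x) // (E x')].
rewrite -(card_in_imset ginj) -(card_imset _ Sinj); apply: subset_leq_card.
apply/subsetP => _ /imsetP[x xt ->]; move: xt; rewrite inE => /and3P[_ _ /exists_inP[y0 y0c y0x]].
rewrite /g; case: pickP => [y /andP[yc _]|/(_ y0)]; last by rewrite y0c y0x.
exact: imset_f.
Qed.

Let tl y := if cutl y then y else rep (rt y).
(* Constant on the components of [G - (S :|: term)]: a cut leaf is its own label, and what
   remains of a class is labelled by its representative. *)
Let lab x : option G :=
  if x \in T then Some (tl x)
  else if [pick y in tnbr T (comp W x)] is Some y then
    Some (if comp W x \in B then rep (rt y) else tl y)
  else None.

(** A surviving vertex of a big component has no cut leaf as neighbour, so all its neighbours in [T]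
    carry the label of the class. Any other odd component has a single attachment and inherits its
    label. *)
Lemma lab_edge x y : x \notin S :|: term -> y \notin S :|: term -> edge x y -> lab x = lab y.
Proof.
have TW u v : u \in T -> v \in W -> v \notin term -> edge u v -> lab u = lab v.
  move=> uT vW vt uv; have [CO uC] := mem_tnbr biST uT vW uv.
  have vT : v \notin T by move: vW; rewrite !inE => /norP[].
  rewrite /lab uT (negPf vT); case: pickP => [w wC|no]; last by have := no u; rewrite uC.
  congr Some; case: (boolP (comp W v \in B)) => CB.
    have -> : rt w = rt u by apply: rt_hrel; apply/exists_inP; exists (comp W v); rewrite ?wC.
    rewrite /tl ifN //; apply: contra vt => ucut; rewrite inE vW CB.
    by apply/exists_inP; exists u; rewrite ?inE.
  congr tl; move: CB; rewrite inE CO /= -leqNgt => C2.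
  have /eqP/cards1P[z CE] : #|tnbr T (comp W v)| = 1.
    by have := tnbr_odd biST CO; move: C2; case: #|_| => [|[|[]]].
  by move: uC wC; rewrite CE => /set1P -> /set1P ->.
rewrite !in_setU !negb_or => /andP[xS xt] /andP[yS yt] exy.
have inW u : u \notin S -> (u \in W) = (u \notin T) by move=> uS; rewrite !inE (negPf uS).
case: (boolP (x \in T)) => xT; case: (boolP (y \in T)) => yT.
- by have := barrier_indep biST xT yT; rewrite exy.
- by apply: TW => //; rewrite inW.
- by apply/esym; apply: TW; rewrite ?inW // edge_sym.
have E : comp W x = comp W y by apply: comp_edge; rewrite ?inW.
by rewrite /lab (negPf xT) (negPf yT) E.
Qed.

Lemma card_lab : #|cuts| + #|cls| <= #|lab @: ~: (S :|: term)|.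
Proof.
have Sinj : injective (@Some G) by move=> i j [].
pose reps := [set rep (rt y) | y in T].
have creps : #|reps| = #|cls|.
  rewrite -(@card_in_imset _ _ rep cls); first by rewrite /cls -imset_comp.
  move=> _ _ /imsetP[y yT ->] /imsetP[z zT ->] /(congr1 rt).
  by have [_ -> _] := repP yT; have [_ -> _] := repP zT.
have dis : [disjoint cuts & reps].
  rewrite -setI_eq0; apply/eqP/setP => u; rewrite !inE; apply/negP => /andP[].
  move=> /and3P[uT _ /eqP nu] /imsetP[y yT uE]; apply: nu; rewrite uE.
  by have [_ -> _] := repP yT.
have -> : #|cuts| + #|cls| = #|[set Some y | y in cuts :|: reps]|.
  by rewrite card_imset // cardsU -creps (eqP (_ : cuts :&: reps == set0)) ?setI_eq0 //
    cards0 subn0.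
have TU y : y \in T -> y \in ~: (S :|: term).
  move=> yT; rewrite !inE yT !orbT /= orbF.
  by rewrite (disjointFl (biased_disjoint biST) yT).
apply: subset_leq_card; apply/subsetP => _ /imsetP[u + ->]; case/setUP => [uc|/imsetP[y yT ->]].
  have uT : u \in T by move: uc; rewrite inE => /and3P[].
  apply/imsetP; exists u; first exact: TU.
  by rewrite /lab uT /tl; move: uc; rewrite inE => ->.
have [rT rE _] := repP yT.
apply/imsetP; exists (rep (rt y)); first exact: TU.
rewrite /lab rT /tl rE; case: ifP => // /and3P[_ _]; by rewrite rE.
Qed.


Lemma tnbr_T C y : y \in tnbr T C -> y \in T.
Proof. by rewrite inE => /andP[]. Qed.

Lemma big_comp_tnbr C : C \in B -> exists y, y \in tnbr T C.
Proof.
rewrite inE => /andP[_ C2]; have /card_gt0P[y yC] : 0 < #|tnbr T C| by apply: leq_trans C2.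
by exists y.
Qed.

Lemma T_neq0 : exists y, y \in T.
Proof.
case: (set_0Vmem T) => [T0|[y yT]]; last by exists y.
have B0 : B = set0.
  apply/setP => C; rewrite in_set0; apply/negP => /big_comp_tnbr[y /tnbr_T].
  by rewrite T0 inE.
have := barrier_count biST; rewrite -/B B0 T0 !cards0; clear; lia.
Qed.

(** Toughness gives [3(c + e) <= 2(|S| + c)] for [c] cut leaves and [e] classes, so [2|S| >= c + 3e]
    can be substituted in [barrier_count]. *)
Lemma total_count :
  #|cuts| + 3 * #|cls| + \sum_(y in T) d y + 1 <= 2 * #|T| + #|B|.
Proof.
have dE : \sum_(y in T) d y = \sum_(C in B) #|tnbr T C|.
  have -> : \sum_(y in T) d y = \sum_(y in T) \sum_(C in B) (y \in tnbr T C).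
    apply: eq_bigr => y _; rewrite /d /fdeg -sum1_card big_mkcond [RHS]big_mkcond.
    by apply: eq_bigr => C _; rewrite inE; case: (C \in B); case: (y \in _).
  rewrite exchange_big; apply: eq_bigr => C _ /=.
  rewrite -sum1_card big_mkcond [RHS]big_mkcond; apply: eq_bigr => y _.
  by case: ifP => yT; case: (boolP (y \in tnbr T C)) => // /tnbr_T; rewrite yT.
have cS : 0 < #|S| by rewrite card_gt0 biased_tough_S_neq0.
have cU : #|S :|: term| <= #|S| + #|cuts|.
  by apply: leq_trans (leq_card_setU _ _).1 _; rewrite leq_add2l card_term.
have tough2 := labels_tough lab_edge card_lab.
have c0 : 0 < #|cls|.
  by have [y yT] := T_neq0; apply/card_gt0P; exists (rt y); apply: imset_f.
have := barrier_count biST; rewrite dE -/B.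
move: cS cU tough2 c0; move: #|S :|: _| #|S| #|cuts| #|cls| => a b c e.
move: (\sum_(C in B) _) #|T| #|B| => sm t p; clear => cS cU tough2 c0 bar.
(* With a single label toughness says nothing; then [c = 0], [e = 1], and [S] being nonempty gives
   only [2|S| >= 2] instead of 3. This is why one unit of the slack 2 is given up. *)
case: (leqP (c + e) 1) => ce; last by have := tough2 ce; lia.
by have : c = 0 /\ e = 1; [lia | case=> -> ->; lia].
Qed.

Let y0 := xchoose T_neq0.
Definition crt C := odflt y0 (omap rt [pick y in tnbr T C]).

Lemma crtE C y : C \in B -> y \in tnbr T C -> crt C = rt y.
Proof.
move=> CB yC; rewrite /crt; case: pickP => [z zC|no] /=; last by have := no y; rewrite yC.
by apply: rt_hrel; apply/exists_inP; exists C; rewrite ?zC.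
Qed.

Definition classT r := [set y in T | rt y == r].
Definition classB r := [set C in B | crt C == r].

(** If every class had surplus at most 3, summing over the classes would contradict
    [total_count]. *)
Lemma exists_class : exists2 r, r \in cls &
  \sum_(y in classT r) (d y + (y \in cuts)) + 4 <= 2 * #|classT r| + #|classB r|.
Proof.
apply/exists_inP; apply: contraT; rewrite negb_exists_in => /forall_inP no.
have sumT (f : G -> nat) : \sum_(y in T) f y = \sum_(r in cls) \sum_(y in classT r) f y.
  rewrite (partition_big rt (mem cls)) => [|y yT]; last exact: imset_f.
  by apply: eq_bigr => r _; apply: eq_bigl => y; rewrite inE.
have sumB : #|B| = \sum_(r in cls) #|classB r|.
  rewrite -sum1_card (partition_big crt (mem cls)) => [|C CB].
    by apply: eq_bigr => r _; rewrite -sum1_card; apply: eq_bigl => C; rewrite [RHS]inE.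
  by have [y yC] := big_comp_tnbr CB; rewrite (crtE CB yC); apply: imset_f (tnbr_T yC).
have cT : #|T| = \sum_(r in cls) #|classT r|.
  by rewrite -sum1_card sumT; apply: eq_bigr => r _; rewrite sum1_card.
have cC : #|cuts| = \sum_(y in T) (y \in cuts).
  rewrite -sum1_card big_mkcond [RHS]big_mkcond; apply: eq_bigr => y _.
  by rewrite inE /cutl; case: (y \in T) => //=; case: (leaf y && _).
have : \sum_(r in cls) (2 * #|classT r| + #|classB r|) <=
    \sum_(r in cls) (\sum_(y in classT r) (d y + (y \in cuts)) + 3).
  by apply: leq_sum => r /no; rewrite -ltnNge addnS ltnS.
have c2T : \sum_(r in cls) 2 * #|classT r| = 2 * #|T| by rewrite cT big_distrr.
rewrite big_split c2T -sumB big_split /= sum_nat_const -sumT big_split /= -cC.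
have := total_count; move: #|cuts| #|cls| #|T| #|B| (\sum_(y in T) _); clear; lia.
Qed.

Lemma mem_classB r C y : C \in B -> y \in tnbr T C -> (C \in classB r) = (y \in classT r).
Proof. by move=> CB yC; rewrite [LHS]inE [RHS]inE CB (crtE CB yC) (tnbr_T yC). Qed.

Lemma fdeg_class r y : fdeg (tnbr T) (classB r) y = if y \in classT r then d y else 0.
Proof.
rewrite /d /fdeg; case: ifPn => yr.
  apply: eq_card => C; rewrite [LHS]inE [RHS]inE andbC [RHS]andbC.
  case: (boolP (y \in tnbr T C)) => //= yC; case: (boolP (C \in B)) => CB.
    by rewrite (mem_classB r CB yC).
  by apply/negbTE; apply: contra CB; rewrite inE => /andP[].
apply/eqP; rewrite cards_eq0; apply/eqP/setP => C; rewrite in_set0 inE.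
apply/negP => /andP[CF yC]; have CB : C \in B by move: CF; rewrite inE => /andP[].
by case/negP: yr; rewrite -(mem_classB r CB yC).
Qed.

Lemma classB_connected r : fconnected (tnbr T) (classB r).
Proof.
apply/forallP => X; apply/negP => /and4P[XF /set0Pn[C CX] nXF /forall_inP clX].
case/negP: nXF; rewrite eqEsubset XF /=; apply/subsetP => C' C'F.
have [C'B] : C' \in B /\ crt C' == r by move: C'F; rewrite inE => /andP[].
have [CB] : C \in B /\ crt C == r by move: (subsetP XF C CX); rewrite inE => /andP[].
have [y yC] := big_comp_tnbr CB; have [y' y'C'] := big_comp_tnbr C'B.
rewrite (crtE CB yC) (crtE C'B y'C') => /eqP ry /eqP ry'.
have step z D D' : D \in X -> z \in tnbr T D -> D' \in classB r -> z \in tnbr T D' -> D' \in X.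
  move=> DX zD D'F zD'; apply: contraT => D'X; have /forall_inP := clX D DX.
  move=> /(_ D'); rewrite in_setD D'X D'F => /(_ isT) /disjointFr /(_ zD).
  by rewrite zD'.
have : connect hrel y y' by rewrite -(fingraph.root_connect hrel_csym) -/rt ry ry'.
case/connectP => p pth y'E; elim: p y C CX CB yC ry pth y'E => [|z p IH] y C CX CB yC ry /=.
  by move=> _ y'E; apply: (step y C) => //; rewrite -y'E.
case/andP => /exists_inP[D DB /andP[yD zD]] pth y'E.
have DX : D \in X by apply: (step y C) => //; rewrite inE DB (crtE DB yD) ry eqxx.
apply: (IH z D) => //; by rewrite -(rt_hrel (y := y)) //; apply/exists_inP; exists D; rewrite ?yD.
Qed.

(** In a class with a vertex other than a leaf the representative is no leaf, so all leaves are cut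
    and each vertex is charged exactly [2 + (d y - 2)], with truncated subtraction. The terms [2]
    cancel against [2 * #|classT r|]. *)
Lemma exists_rich_class : exists F : {set {set G}},
  [/\ F \subset B, fconnected (tnbr T) F & 4 + excess (tnbr T) F <= #|F| ].
Proof.
have [r rc cnt] := exists_class; exists (classB r).
split; [by apply/subsetP => C; rewrite inE => /andP[] | exact: classB_connected |].
have excE : excess (tnbr T) (classB r) = \sum_(y in classT r) (d y - 2).
  rewrite /excess [RHS]big_mkcond; apply: eq_bigr => y _; rewrite fdeg_class.
  by case: ifP.
have inF C y : C \in B -> y \in tnbr T C -> (C \in classB r) = (rt y == r).
  by move=> CB yC; rewrite inE CB (crtE CB yC).
(* A vertex in no hyperedge would form its class alone, and the count would read 4 at most 2. *)
have d0 y : y \in classT r -> 0 < d y.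
  rewrite lt0n => yr; apply/negP => /eqP dy0.
  have noC C : C \in B -> y \in tnbr T C -> False.
    move=> CB yC; move/eqP: dy0; rewrite cards_eq0 => /eqP E.
    by have := in_set0 C; rewrite -E inE CB yC.
  have only z : z \in classT r -> z = y.
    rewrite inE => /andP[_ /eqP zr]; move: yr; rewrite inE => /andP[_ /eqP yr].
    have : connect hrel y z by rewrite -(fingraph.root_connect hrel_csym) -/rt yr zr.
    case/connectP => -[|u p] //= /andP[/exists_inP[C CB /andP[yC _]] _].
    by case: (noC C).
  have cT1 : #|classT r| <= 1.
    by apply/card_le1_eqP => u v /only -> /only ->.
  have F0 : classB r = set0.
    apply/setP => C; rewrite in_set0; apply/negP => CF.
    have CB : C \in B by move: CF; rewrite inE => /andP[].
    have [z zC] := big_comp_tnbr CB.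
    have zy : z = y by apply: only; rewrite -(mem_classB r CB zC).
    by apply: (noC C); rewrite // -zy.
  by move: cnt cT1; rewrite F0 cards0; clear; lia.
have [yr yT rE] := imsetP rc.
have [repT repr_rt repnl] := repP yT.
case: (boolP [exists y in classT r, ~~ leaf y]) => [/exists_inP[z zr nlz]|].
  suff : \sum_(y in classT r) (d y + (y \in cuts)) = 2 * #|classT r| + excess (tnbr T) (classB r).
    by move=> E; move: cnt; rewrite E; move: #|classT r| #|classB r|; clear; lia.
  rewrite excE mulnC -sum_nat_const -big_split /=; apply: eq_bigr => y yr'.
  have [yT' /eqP yrt] : y \in T /\ rt y == r by move: yr'; rewrite inE => /andP[].
  rewrite inE /cutl yT' yrt rE /=.
  have nl : ~~ leaf (rep (rt yr)).
    apply: repnl; exists z; move: zr; rewrite inE => /andP[zT /eqP zrt]; split=> //.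
    by rewrite zrt rE.
  have -> : leaf y && (y != rep (rt yr)) = leaf y.
    by rewrite andb_idr // => ly; apply: contraNneq nl => <-.
  have := d0 y yr'; rewrite /leaf; case: (d y) => [|[|k]] //; clear; lia.
rewrite negb_exists_in => /forall_inP allleaf; exfalso.
have leafr y : y \in classT r -> d y = 1 by move=> /allleaf; rewrite negbK => /eqP.
(* If all vertices were leaves, only the representative would be charged 1 instead of 2, leaving at
   least three hyperedges; but connectedness makes two of them share a vertex, which is then no
   leaf. *)
have F3 : 3 <= #|classB r|.
  have : 2 * #|classT r| <= \sum_(y in classT r) (d y + (y \in cuts)) + 1.
    have repr : rep (rt yr) \in classT r by rewrite inE repT repr_rt rE eqxx.
    rewrite (big_setD1 _ repr) /= (leafr _ repr) (cardsD1 (rep (rt yr))) repr.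
    have : 2 * #|classT r :\ rep (rt yr)| <=
        \sum_(y in classT r :\ rep (rt yr)) (d y + (y \in cuts)).
      rewrite mulnC -sum_nat_const; apply: leq_sum => y; rewrite in_setD1 => /andP[yrep yr'].
      rewrite inE /cutl /leaf (leafr y yr') eqxx /=.
      by move: yr'; rewrite inE => /andP[-> /eqP ->]; rewrite rE yrep.
    by move: #|_ :\ _| (\sum_(y in _ :\ _) _); clear; lia.
  by move: cnt; move: #|classT r| #|classB r| (\sum_(y in _) _); clear; lia.
have /card_gt0P[C CF] : 0 < #|classB r| by apply: leq_trans F3.
have [|||u [v [y [/set1P -> vF]]]] := fconnected_share (classB_connected r) (X := [set C]).
- by rewrite sub1set.
- by apply/set0Pn; exists C; rewrite set11.
- by apply: contraTneq F3 => <-; rewrite cards1.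
rewrite in_set1 => vC yC yv.
have CB : C \in B by move: CF; rewrite inE => /andP[].
have vB : v \in B by move: vF; rewrite inE => /andP[].
have := leafr y; rewrite -(mem_classB r CB yC) => /(_ CF) /eqP/cards1P[D DE].
have E K : K \in B -> y \in tnbr T K -> K = D by move=> KB yK; apply/set1P; rewrite -DE inE KB.
by case/eqP: vC; rewrite (E C) // (E v).
Qed.
End ToughBarrier.

(** * Assembly *)

Lemma ipath_extend (G : sgraph) (a b x : G) (q s : seq G) :
  ipath (x :: q) -> ipath (b :: s) ->
  (forall u, u \in x :: q -> u != a /\ edge a u = (u == x)) ->
  (forall u, u \in x :: q -> u != b /\ edge b u = (u == last x q)) ->
  (forall u w, u \in x :: q -> w \in s -> u != w /\ edge u w = false) ->
  (forall w, w \in b :: s -> a != w /\ edge a w = false) ->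
  ipath (a :: (x :: q) ++ b :: s).
Proof.
move=> ipq ips ha hb hs has_.
have bs : b \notin s by move: ips => /= /andP[].
apply: (@ipath_cat G x [:: a] ((x :: q) ++ b :: s)) => //.
  apply: (@ipath_cat G x) => // u v uq; rewrite inE => /predU1P[->|vs].
    by have [ub ubE] := hb u uq; rewrite ub edge_sym ubE eqxx andbT.
  have [-> ->] := hs u v uq vs; rewrite /= (_ : (v == b) = false) ?andbF //.
  by apply: contraNF bs => /eqP <-.
move=> u v; rewrite mem_seq1 => /eqP -> /=; rewrite eqxx -cat_cons mem_cat => /orP[vq|vs].
  by have [va ->] := ha v vq; rewrite eq_sym va.
have [-> ->] := has_ v vs; split=> //; apply/esym.
apply/negbTE/negP => /eqP vx; have [xb xbE] := hb x (mem_head _ _).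
by move: vs; rewrite vx inE => /predU1P[xb'|xs];
  [rewrite xb' eqxx in xb | have [] := hs x x (mem_head _ _) xs; rewrite eqxx].
Qed.

Section Assembly.
Variables (G : sgraph) (S T : {set G}).
Hypothesis biST : biased S T.
Let W := ~: (S :|: T).
Let B := big_comps S T.

(** Crossings of different components are never adjacent and [T] is independent, so only edges
    between the chosen vertices and the crossings can spoil inducedness; the links control these.
    Longer paths are truncated to 10 and 4 vertices. *)
Lemma config_induced_paths : config (tnbr T) B (tlink T) ->
  exists U : {set G}, isomorphic (induced U) (disjoint_union (path_graph 4) (path_graph 10)).
Proof.
move=> [v1 [v2 [v3 [v4 [y1 [y2 [y3 [y4 [y5 [y6 [Z []]]]]]]]]]]].
move=> /and5P[v1B v2B v3B v4B _] unv uny Zall [].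
move=> [x1 [q1 [ip1 sub1 [y1T y2T] [y12 e1 f1] h1]]].
move=> [x2 [q2 [ip2 sub2 [_ y3T] [y23 e2 f2] h2]]].
move=> [x3 [q3 [ip3 sub3 [_ y4T] [y34 e3 f3] h3]]].
move=> [x4 [q4 [ip4 sub4 [y5T y6T] [y56 e4 f4] h4]]].
pose Y := [:: y1; y2; y3; y4; y5; y6].
have YT y : y \in Y -> y \in T.
  by rewrite !inE => /or4P[||| /or3P[]] /eqP ->.
have tt y z : y \in T -> z \in T -> edge y z = false.
  by move=> yT zT; apply/negbTE/(barrier_indep biST).
have inW C u : C \in B -> u \in C -> u \in W.
  by move=> /big_comp_odd /odd_comp_sub /subsetP; apply.
have ct C u y : C \in B -> u \in C -> y \in T -> u != y.
  move=> CB uC yT; apply: contraTneq (inW C u CB uC) => ->.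
  by rewrite in_setC in_setU yT orbT.
have cc C C' u w : C \in B -> C' \in B -> C != C' -> u \in C -> w \in C' ->
    u != w /\ edge u w = false.
  move=> CB C'B CC' uC wC'.
  have uE : comp W u = C by apply: (odd_comp_eq (big_comp_odd CB)).
  have wE : comp W w = C' by apply: (odd_comp_eq (big_comp_odd C'B)).
  split; first by apply: contraNneq CC' => uw; rewrite -uE -wE uw.
  apply: contraNF CC' => uw; rewrite -uE -wE; apply/eqP/comp_edge => //.
    exact: inW uC.
  exact: inW wC'.
have l1 y u : y \in Y -> u \in x1 :: q1 ->
    edge y u = (y == y1) && (u == x1) || (y == y2) && (u == last x1 q1).
  by move=> yY uq; apply: h1 (YT y yY).
have l3 y u : y \in Y -> u \in x3 :: q3 ->
    edge y u = (y == y3) && (u == x3) || (y == y4) && (u == last x3 q3).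
  by move=> yY uq; apply: h3 (YT y yY).
have l4 y u : y \in Y -> u \in x4 :: q4 ->
    edge y u = (y == y5) && (u == x4) || (y == y6) && (u == last x4 q4).
  by move=> yY uq; apply: h4 (YT y yY).
(* A chosen vertex attached to [v2] lies in [Z] and is controlled by the link; any other has no
   neighbour in [v2] at all. *)
have l2 y u : y \in Y -> u \in x2 :: q2 ->
    edge y u = (y == y2) && (u == x2) || (y == y3) && (u == last x2 q2).
  move=> yY uq; have [yv|yv] := boolP (y \in tnbr T v2).
    by apply: h2 (YT y yY) => //; apply: (allP Zall); rewrite mem_filter yv.
  have yu : edge y u = false.
    apply: contraNF yv => yu; rewrite inE YT //; apply/exists_inP; exists u => //.
    exact: sub2.
  rewrite yu; apply/esym/negbTE/negP => /orP[] /andP[/eqP yE /eqP uE]; move: yu.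
    by rewrite yE uE e2.
  by rewrite yE uE f2.
(* A crossing of one vertex would have two neighbours in [T]. *)
have two C a b x q : C \in B -> {subset x :: q <= C} -> a \in T -> b \in T -> a != b ->
    edge a x -> edge b (last x q) -> 1 < size (x :: q).
  move=> CB sub aT bT ab ax; case: q sub => [|z q] //= sub bx.
  case/eqP: ab; apply: (rest_nbr_uniq biST _ aT bT ax bx).
  by apply: inW CB _; apply: sub; rewrite mem_head.
have n1 := two v1 y1 y2 x1 q1 v1B sub1 y1T y2T y12 e1 f1.
have n2 := two v2 y2 y3 x2 q2 v2B sub2 y2T y3T y23 e2 f2.
have n3 := two v3 y3 y4 x3 q3 v3B sub3 y3T y4T y34 e3 f3.
have n4 := two v4 y5 y6 x4 q4 v4B sub4 y5T y6T y56 e4 f4.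
have [Y1 Y2 Y3] : [/\ y1 \in Y, y2 \in Y & y3 \in Y] by rewrite !inE !eqxx !orbT.
have [Y4 Y5 Y6] : [/\ y4 \in Y, y5 \in Y & y6 \in Y] by rewrite !inE !eqxx !orbT.
move: uny; rewrite /= !inE !negb_or andbT => /and5P[].
move=> /and5P[_ y13 y14 y15 y16] /and4P[_ y24 y25 y26] /and3P[_ y35 y36] /andP[y45 y46] _.
move: unv; rewrite /= !inE !negb_or andbT => /and3P[/and3P[v12 v13 v14] /andP[v23 v24] v34].
have neq (y z : G) : y != z -> ((y == z) = false) * ((z == y) = false).
  by move=> yz; rewrite [z == y]eq_sym (negPf yz).
have in3 w : (w \in (x3 :: q3) ++ [:: y4]) = (w \in x3 :: q3) || (w == y4).
  by rewrite mem_cat mem_seq1.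
have in3' w : (w \in y3 :: (x3 :: q3) ++ [:: y4]) = [|| w == y3, w \in x3 :: q3 | w == y4].
  by rewrite in_cons in3.
have in2 w : (w \in (x2 :: q2) ++ y3 :: (x3 :: q3) ++ [:: y4]) =
    [|| w \in x2 :: q2, w == y3, w \in x3 :: q3 | w == y4].
  by rewrite mem_cat in3'.
have in2' w : (w \in y2 :: (x2 :: q2) ++ y3 :: (x3 :: q3) ++ [:: y4]) =
    [|| w == y2, w \in x2 :: q2, w == y3, w \in x3 :: q3 | w == y4].
  by rewrite in_cons in2.
have seg3 : ipath (y3 :: (x3 :: q3) ++ [:: y4]).
  apply: ipath_extend => //.
  - by move=> u uq; rewrite (ct v3) ?sub3 // l3 // eqxx (neq _ _ y34) orbF.
  - by move=> u uq; rewrite (ct v3) ?sub3 // l3 // eqxx (neq _ _ y34).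
  by move=> w; rewrite mem_seq1 => /eqP ->; rewrite tt.
have seg2 : ipath (y2 :: (x2 :: q2) ++ y3 :: (x3 :: q3) ++ [:: y4]).
  apply: ipath_extend => //.
  - by move=> u uq; rewrite (ct v2) ?sub2 // l2 // eqxx (neq _ _ y23) orbF.
  - by move=> u uq; rewrite (ct v2) ?sub2 // l2 // eqxx (neq _ _ y23).
  - move=> u w uq; rewrite in3 => /orP[wq|/eqP ->].
      by apply: (cc v2 v3); rewrite ?sub2 ?sub3.
    by rewrite (ct v2) ?sub2 // edge_sym l2 // (neq _ _ y24) (neq _ _ y34).
  move=> w; rewrite in3' => /or3P[/eqP ->|wq|/eqP ->].
  - by rewrite tt.
  - by rewrite eq_sym (ct v3) ?sub3 // l3 // (neq _ _ y23) (neq _ _ y24).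
  by rewrite tt.
have seg1 : ipath (y1 :: (x1 :: q1) ++ y2 :: (x2 :: q2) ++ y3 :: (x3 :: q3) ++ [:: y4]).
  apply: ipath_extend => //.
  - by move=> u uq; rewrite (ct v1) ?sub1 // l1 // eqxx (neq _ _ y12) orbF.
  - by move=> u uq; rewrite (ct v1) ?sub1 // l1 // eqxx (neq _ _ y12).
  - move=> u w uq; rewrite in2 => /or4P[wq|/eqP ->|wq|/eqP ->].
    + by apply: (cc v1 v2); rewrite ?sub1 ?sub2.
    + by rewrite (ct v1) ?sub1 // edge_sym l1 // (neq _ _ y13) (neq _ _ y23).
    + by apply: (cc v1 v3); rewrite ?sub1 ?sub3.
    by rewrite (ct v1) ?sub1 // edge_sym l1 // (neq _ _ y14) (neq _ _ y24).
  move=> w; rewrite in2'.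
  case/or4P => [/eqP ->|wq|/eqP ->|/orP[wq|/eqP ->]].
  - by rewrite tt.
  - by rewrite eq_sym (ct v2) ?sub2 // l2 // (neq _ _ y12) (neq _ _ y13).
  - by rewrite tt.
  - by rewrite eq_sym (ct v3) ?sub3 // l3 // (neq _ _ y13) (neq _ _ y14).
  by rewrite tt.
have seg4 : ipath (y5 :: (x4 :: q4) ++ [:: y6]).
  apply: ipath_extend => //.
  - by move=> u uq; rewrite (ct v4) ?sub4 // l4 // eqxx (neq _ _ y56) orbF.
  - by move=> u uq; rewrite (ct v4) ?sub4 // l4 // eqxx (neq _ _ y56).
  by move=> w; rewrite mem_seq1 => /eqP ->; rewrite tt.
pose s := y1 :: (x1 :: q1) ++ y2 :: (x2 :: q2) ++ y3 :: (x3 :: q3) ++ [:: y4].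
pose t := y5 :: (x4 :: q4) ++ [:: y6].
have cross u w : u \in t -> w \in s -> u != w /\ ~~ edge u w.
  have sE : w \in s -> [\/ w \in [:: y1; y2; y3; y4],
      w \in x1 :: q1, w \in x2 :: q2 | w \in x3 :: q3].
    rewrite /s in_cons mem_cat in2'.
    case/or4P => [h|h|h|/or4P[h|h|h|h]].
    - by constructor 1; rewrite inE h.
    - by constructor 2.
    - by constructor 1; rewrite !inE h orbT.
    - by constructor 3.
    - by constructor 1; rewrite !inE h !orbT.
    - by constructor 4.
    by constructor 1; rewrite !inE h !orbT.
  rewrite /t in_cons mem_cat mem_seq1 => ut /sE ws.
  have {}ut : u \in [:: y5; y6] \/ u \in x4 :: q4.
    by case/or3P: ut => h; [left; rewrite inE h | right | left; rewrite !inE h orbT].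
  have y5x w' : w' \in [:: y1; y2; y3; y4] -> [/\ w' \in Y, w' != y5 & w' != y6].
    by rewrite !inE => /or4P[] /eqP ->; rewrite ?Y1 ?Y2 ?Y3 ?Y4 ?eqxx ?orbT; split.
  have cy C u' x q a b : C \in B -> {subset x :: q <= C} -> u' \in [:: y5; y6] -> w \in x :: q ->
      (forall y u, y \in Y -> u \in x :: q ->
        edge y u = (y == a) && (u == x) || (y == b) && (u == last x q)) ->
      a \in [:: y1; y2; y3; y4] -> b \in [:: y1; y2; y3; y4] -> u' != w /\ ~~ edge u' w.
    move=> CB sub u'Y wq l /y5x[_ a5 a6] /y5x[_ b5 b6].
    have u'Y' : u' \in Y by move: u'Y; rewrite !inE => /orP[] ->; rewrite !orbT.
    rewrite eq_sym (ct C) ?sub ?YT // l //.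
    move: u'Y; rewrite !inE => /orP[] /eqP ->.
      by rewrite (neq _ _ a5) (neq _ _ b5).
    by rewrite (neq _ _ a6) (neq _ _ b6).
  case: ut => [uY|uq]; case: ws => [wY|wq|wq|wq].
  - have [w1 w5 w6] := y5x w wY.
    have uT : u \in T by move: uY; rewrite !inE => /orP[] /eqP ->.
    rewrite (tt u w uT (YT w w1)); split=> //.
    by move: uY; rewrite !inE => /orP[] /eqP ->; rewrite eq_sym.
  - by apply: (cy v1 u x1 q1 y1 y2); rewrite // !inE ?eqxx ?orbT.
  - by apply: (cy v2 u x2 q2 y2 y3); rewrite // !inE ?eqxx ?orbT.
  - by apply: (cy v3 u x3 q3 y3 y4); rewrite // !inE ?eqxx ?orbT.
  - have [w1 w5 w6] := y5x w wY.
    by rewrite (ct v4) ?sub4 ?YT // edge_sym l4 // (negPf w5) (negPf w6).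
  - by have [||||| -> ->] := cc v4 v1 u w; rewrite ?sub4 ?sub1 // eq_sym.
  - by have [||||| -> ->] := cc v4 v2 u w; rewrite ?sub4 ?sub2 // eq_sym.
  by have [||||| -> ->] := cc v4 v3 u w; rewrite ?sub4 ?sub3 // eq_sym.
apply: (@induced_disjoint_paths G 3 9 (take 4 t) (take 10 s)).
- exact: ipath_take.
- exact: ipath_take.
- by rewrite size_takel // /t /= size_cat /=; move: n4 => /=; clear; lia.
- rewrite size_takel // /s /= !size_cat /= !size_cat /= !size_cat /=.
  by move: n1 n2 n3 => /=; clear; lia.
by move=> u w /mem_take ut /mem_take ws; apply: cross.
Qed.
End Assembly.

Theorem theorem1p4 (G : sgraph) (hn : (3 <= #|G|)%N)
  (htough : tough (3%:R / 2%:R)%R G)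
  (hfree : induced_free (disjoint_union (path_graph 4) (path_graph 10)) G) :
  has_two_factor G.
Proof.
case: (two_factor_or_barrier G) => [//|/exists_biased[S [T biST]]].
have [F [FB conF rich]] := exists_rich_class hn htough biST.
case: hfree; apply: (config_induced_paths biST).
apply: (connected_config _ _ _ _ FB conF rich).
- by move=> v Z y z; apply: tlinkC.
- move=> v vB; have [y yv] := big_comp_tnbr vB; by apply/set0Pn; exists y.
- exact: (tlink_two biST).
move=> v A A' vB; have [c cW vE] := big_compE vB.
exact: (tlink_across biST cW (subxx _) vE).
Qed.
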